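(* Let $g:\mathbb{R}^n\to\mathbb{R}^s$ be $C^2$, $D\subset\mathbb{R}^s$ closed, $\Gamma=g^{-1}(D)$, $\bar x\in\Gamma$, and assume (A1), (A2). Let $\bar x^*\in\hat N_\Gamma(\bar x)$, let $\bar\lambda$ be the unique vector with $\bar\lambda\in\hat N_D(g(\bar x))$, $\nabla g(\bar x)^T\bar\lambda=\bar x^*$, and let $(u,u^* )\in T_{\operatorname{gph}\hat N_\Gamma}(\bar x,\bar x^* )$. Let $\bar\xi\in\mathbb{R}^s$ be the unique vector satisfying $$(\nabla g(\bar x)u,\bar\xi)\in T_{\operatorname{gph}\hat N_D}(g(\bar x),\bar\lambda),\qquad u^*=\nabla g(\bar x)^T\bar\xi+\nabla^2\langle\bar\lambda,g\rangle(\bar x)u.$$ Then for every $w\in\mathbb{R}^n$, $$D^*\hat N_\Gamma((\bar x,\bar x^* );(u,u^* ))(w)=\nabla^2\langle\bar\lambda,g\rangle(\bar x)w+\nabla g(\bar x)^T\,D^*\hat N_D((g(\bar x),\bar\lambda);(\nabla g(\bar x)u,\bar\xi))(\nabla g(\bar x)w).$$ In particular (taking $(u,u^* )=(0,0)$), $D^*\hat N_\Gamma(\bar x,\bar x^* )(w)=\nabla^2\langle\bar\lambda,g\rangle(\bar x)w+\nabla g(\bar x)^TD^*\hat N_D(g(\bar x),\bar\lambda)(\nabla g(\bar x)w)$.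
   Context: Standing assumptions (A1), (A2) for $g:\mathbb{R}^n\to\mathbb{R}^s$ ($C^2$), closed $D\subset\mathbb{R}^s$, $\Gamma=g^{-1}(D)$, $\bar x\in\Gamma$: (A1) There exist a closed set $\Theta\subset\mathbb{R}^d$, a twice continuously differentiable mapping $h:\mathbb{R}^s\to\mathbb{R}^d$ and a neighborhood $\mathcal V$ of $g(\bar x)$ such that $\nabla h(g(\bar x))$ is surjective and $D\cap\mathcal V=\{z\in\mathcal V\mid h(z)\in\Theta\}$. (A2) $\operatorname{range}\nabla g(\bar x)+\ker\nabla h(g(\bar x))=\mathbb{R}^s$. For closed $A$, $\bar a\in A$: $T_A(\bar a)=\limsup_{t\searrow0}(A-\bar a)/t$; $\hat N_A(\bar a)=(T_A(\bar a))^\circ$ ($\hat N_A(a)=\emptyset$ if $a\notin A$); the directional limiting normal cone in direction $d$ is $N_A(\bar a;d)=\limsup_{t\searrow0,\,d'\to d}\hat N_A(\bar a+td')$ (Painlevé–Kuratowski outer limit); the limiting normal cone is $N_A(\bar a)=N_A(\bar a;0)$. For a closed-graph multifunction $F:\mathbb{R}^n\rightrightarrows\mathbb{R}^z$ with $(\bar u,\bar v)\in\operatorname{gph}F$ and directions $(d,h)$, the directional limiting coderivative is $D^*F((\bar u,\bar v);(d,h))(v^* )=\{u^*\mid(u^*,-v^* )\in N_{\operatorname{gph}F}((\bar u,\bar v);(d,h))\}$, and the limiting coderivative is $D^*F(\bar u,\bar v)=D^*F((\bar u,\bar v);(0,0))$. $\nabla^2\langle\lambda,g\rangle(x)$ is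 the Hessian of $x\mapsto\langle\lambda,g(x)\rangle$. *)

(* Defs.v *)
From mathcomp Require Import all_boot.
From Stdlib Require Import Reals ClassicalEpsilon.
Set Implicit Arguments. Unset Strict Implicit.
Local Open Scope R_scope.

Definition vec (n : nat) := 'I_n -> R.
Definition mat (s n : nat) := 'I_s -> 'I_n -> R.
Definition vset (n : nat) := vec n -> Prop.

Definition vzero (n : nat) : vec n := fun _ => 0.
Definition vadd n (u v : vec n) : vec n := fun i => u i + v i.
Definition vopp n (u : vec n) : vec n := fun i => - u i.
Definition vsub n (u v : vec n) : vec n := fun i => u i - v i.
Definition vscal n (t : R) (u : vec n) : vec n := fun i => t * u i.
Definition ebasis n (j : 'I_n) : vec n := fun i => if i == j then 1 else 0.
Definition dot n (u v : vec n) : R := \big[Rplus/0]_(i < n) (u i * v i).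
Definition vnorm n (u : vec n) : R := sqrt (dot u u).

Definition mulmv s n (A : mat s n) (u : vec n) : vec s := fun i => dot (A i) u.
Definition trmulmv s n (A : mat s n) (v : vec s) : vec n :=
  fun j => \big[Rplus/0]_(i < s) (A i j * v i).

Definition vcat n m (u : vec n) (v : vec m) : vec (n + m) :=
  fun i => match fintype.split i with inl j => u j | inr k => v k end.
Definition vfst n m (p : vec (n + m)) : vec n := fun j => p (lshift m j).
Definition vsnd n m (p : vec (n + m)) : vec m := fun k => p (rshift n k).

Definition seq_cvg n (x : nat -> vec n) (a : vec n) : Prop :=
  forall eps, 0 < eps -> exists N : nat, forall k : nat, is_true (leq N k) ->
    vnorm (vsub (x k) a) < eps.

Definition vclosed n (A : vset n) : Prop :=
  forall (x : nat -> vec n) (a : vec n), (forall k, A (x k)) -> seq_cvg x a -> A a.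

(* T_A(a) = limsup_{t \searrow 0} (A - a)/t  (Painleve-Kuratowski outer limit) *)
Definition tangent_cone n (A : vset n) (a : vec n) : vset n := fun d =>
  exists (t : nat -> R) (dk : nat -> vec n),
    (forall k, 0 < t k) /\ Un_cv t 0 /\ seq_cvg dk d /\
    (forall k, A (vadd a (vscal (t k) (dk k)))).

Definition reg_normal n (A : vset n) (a : vec n) : vset n := fun v =>
  A a /\ forall d, tangent_cone A a d -> dot v d <= 0.

Definition lim_normal_dir n (A : vset n) (a d : vec n) : vset n := fun v =>
  exists (t : nat -> R) (dk vk : nat -> vec n),
    (forall k, 0 < t k) /\ Un_cv t 0 /\ seq_cvg dk d /\ seq_cvg vk v /\
    (forall k, reg_normal A (vadd a (vscal (t k) (dk k))) (vk k)).

Definition lim_normal n (A : vset n) (a : vec n) : vset n :=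
  lim_normal_dir A a (@vzero n).

Definition gph n z (F : vec n -> vset z) : vset (n + z) :=
  fun p => F (vfst p) (vsnd p).

Definition dir_coderiv n z (F : vec n -> vset z) (u : vec n) (v : vec z)
  (d : vec n) (h : vec z) (vs : vec z) : vset n := fun us =>
  lim_normal_dir (gph F) (vcat u v) (vcat d h) (vcat us (vopp vs)).

Definition coderiv n z (F : vec n -> vset z) (u : vec n) (v : vec z)
  (vs : vec z) : vset n :=
  dir_coderiv F u v (@vzero n) (@vzero z) vs.

Definition is_partial n (f : vec n -> R) (j : 'I_n) (x : vec n) (l : R) : Prop :=
  derivable_pt_lim (fun t => f (vadd x (vscal t (ebasis j)))) 0 l.

(* the partial derivative (meaningful when it exists) *)
Definition pderiv n (f : vec n -> R) (j : 'I_n) (x : vec n) : R :=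
  epsilon (inhabits 0) (fun l => is_partial f j x l).

Definition vcontinuous n (f : vec n -> R) : Prop :=
  forall x eps, 0 < eps -> exists del, 0 < del /\
    forall y, vnorm (vsub y x) < del -> Rabs (f y - f x) < eps.

Definition C2_scalar n (f : vec n -> R) : Prop :=
  (forall j x, exists l, is_partial f j x l) /\
  (forall j k x, exists l, is_partial (pderiv f j) k x l) /\
  (forall j, vcontinuous (pderiv f j)) /\
  (forall j k, vcontinuous (pderiv (pderiv f j) k)).

Definition C2 n s (g : vec n -> vec s) : Prop :=
  forall i, C2_scalar (fun x => g x i).

Definition jacobian n s (g : vec n -> vec s) (x : vec n) : mat s n :=
  fun i j => pderiv (fun y => g y i) j x.
Definition hessian n (f : vec n -> R) (x : vec n) : mat n n :=
  fun j k => pderiv (pderiv f j) k x.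

(* Standing assumptions (A1) and (A2) (A2 refers to the h of (A1)) *)
Definition A1_A2 n s (g : vec n -> vec s) (D : vset s) (xb : vec n) : Prop :=
  exists (d : nat) (Theta : vset d) (h : vec s -> vec d) (V : vset s),
    vclosed Theta /\ C2 h /\
    (exists r, 0 < r /\ forall z, vnorm (vsub z (g xb)) < r -> V z) /\
    (forall y : vec d, exists v : vec s, mulmv (jacobian h (g xb)) v = y) /\
    (forall z, V z -> (D z <-> Theta (h z))) /\
    (forall y : vec s, exists (u : vec n) (v : vec s),
        mulmv (jacobian h (g xb)) v = @vzero d /\
        y = vadd (mulmv (jacobian g xb) u) v).

(* Main.v *)
(** Suppose a C^2 map f has surjective derivative F(x) and A = f^-1(Theta) near x.
Then N_A = F^T N_Theta(f) near x, so gph N_A is the image under the immersion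
(x, mu) |-> (x, F(x)^T mu) of the preimage of gph N_Theta under the submersion
(x, mu) |-> (f x, mu). Writing B for the Hessian of <mu, f> at x, tangents to
gph N_A at (x, F^T mu) are the (u, F^T m + B u) with (F u, m) tangent to
gph N_Theta at (f x, mu), and polarity turns this into: (p, q) is normal to gph N_A
iff p + B q = F^T a with (a, F q) normal to gph N_Theta. Lyusternik's theorem lifts
sequences through f, so this passes to directional limiting normals. Under (A1) and
(A2) it applies to h with A = D and to h o g with A = Gamma, and the chain rule
B_{h o g}(mu) = J^T B_h(mu) J + B_g(H^T mu) relates the two formulas. *)

(* The derivative of g need not be surjective, so Gamma is never treated as a smooth preimage of D.
   (A2) only makes the derivative of h o g surjective; hence both graphs are compared with gph
   N_Theta, at one common multiplier mu. Two obstacles remain once regular normals are understood.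
   Transporting a sequence of normals yields its multipliers index by index, whereas directional
   limits require their difference quotients to converge. This holds because F(x_k)^T a_k converges
   and a right inverse Q of F(x) is almost one of F(x_k). Conversely, a sequence b_k converging to
   F(x) q must be met exactly by F(x_k) q_k with q_k converging to q. That linear lift and
   Lyusternik's nonlinear one rest on the same contraction with constant one half. Contraction needs
   two-point estimates, which is why strict differentiability is extracted from the continuous
   partial derivatives. *)
Require Import Defs.
From HB Require Import structures.
From mathcomp Require Import all_boot.
From Stdlib Require Import Reals Lra FunctionalExtensionality ClassicalEpsilon.
From Coquelicot Require Derive Derive_2d Continuity.
Set Implicit Arguments. Unset Strict Implicit.
Local Open Scope R_scope.

(** * Vectors, matrices and sequences *)

Lemma RplusA : associative Rplus. Proof. by move=> x y z; ring. Qed.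
Lemma RplusC : commutative Rplus. Proof. by move=> x y; ring. Qed.
Lemma Rplus0x : left_id 0 Rplus. Proof. by move=> x; ring. Qed.
Lemma Rmult0x : left_zero 0 Rmult. Proof. by move=> x; ring. Qed.
Lemma Rmultx0 : right_zero 0 Rmult. Proof. by move=> x; ring. Qed.
Lemma RmultDl : left_distributive Rmult Rplus. Proof. by move=> x y z; ring. Qed.
Lemma RmultDr : right_distributive Rmult Rplus. Proof. by move=> x y z; ring. Qed.
HB.instance Definition _ := Monoid.isComLaw.Build R 0 Rplus RplusA RplusC Rplus0x.
HB.instance Definition _ := Monoid.isMulLaw.Build R 0 Rmult Rmult0x Rmultx0.
HB.instance Definition _ := Monoid.isAddLaw.Build R Rmult Rplus RmultDl RmultDr.

Local Notation rsum n F := (\big[Rplus/0]_(i < n) F i).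

Lemma rsumD n (F G : 'I_n -> R) :
  \big[Rplus/0]_(i < n) (F i + G i) = rsum n F + rsum n G.
Proof. by rewrite big_split. Qed.

Lemma rsumZ n c (F : 'I_n -> R) :
  \big[Rplus/0]_(i < n) (c * F i) = c * rsum n F.
Proof. by rewrite big_distrr. Qed.

Lemma rsumZr n c (F : 'I_n -> R) :
  \big[Rplus/0]_(i < n) (F i * c) = rsum n F * c.
Proof. by rewrite big_distrl. Qed.

Lemma rsum_le n (F G : 'I_n -> R) :
  (forall i, F i <= G i) -> rsum n F <= rsum n G.
Proof.
by move=> FG; apply: (big_ind2 (fun a b => a <= b)) => [|a b c e ? ?|i _]; [lra|lra|exact: FG].
Qed.

Lemma rsum_eq0 n (F : 'I_n -> R) : (forall i, F i = 0) -> rsum n F = 0.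
Proof. by move=> F0; rewrite big1. Qed.

Lemma rsum_ge0 n (F : 'I_n -> R) : (forall i, 0 <= F i) -> 0 <= rsum n F.
Proof. by move=> F0; apply: (big_ind (fun a => 0 <= a)) => [|a b ? ?|i _]; [lra|lra|exact: F0]. Qed.

Lemma Rabs_rsum n (F : 'I_n -> R) :
  Rabs (rsum n F) <= \big[Rplus/0]_(i < n) Rabs (F i).
Proof.
apply: (big_ind2 (fun a b => Rabs a <= b)) => [|a b c d ab cd|i _].
- by rewrite Rabs_R0; lra.
- by have := Rabs_triang a c; lra.
- by lra.
Qed.

Lemma le_rsum n (F : 'I_n -> R) j : (forall i, 0 <= F i) -> F j <= rsum n F.
Proof.
move=> F0; rewrite (bigD1 j) //=.
have : 0 <= \big[Rplus/0]_(i < n | i != j) F i.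
  by apply: (big_ind (fun a => 0 <= a)) => [|a b ? ?|i _]; [lra|lra|exact: F0].
by move=> H; rewrite -{1}(Rplus_0_r (F j)); exact: Rplus_le_compat_l.
Qed.

Lemma rsum_delta n (F : 'I_n -> R) j :
  \big[Rplus/0]_(i < n) (F i * ebasis j i) = F j.
Proof.
rewrite (bigD1 j) //= /ebasis eqxx big1 => [|i /negbTE ->]; first by ring.
by ring.
Qed.

Ltac vext := let i := fresh "i" in
  apply: functional_extensionality => i; rewrite /vadd /vsub /vscal /vopp /vzero.

Lemma dotC n (u v : vec n) : dot u v = dot v u.
Proof. by apply: eq_bigr => i _; ring. Qed.

Lemma dotDr n (u v w : vec n) : dot u (vadd v w) = dot u v + dot u w.
Proof. by rewrite -rsumD; apply: eq_bigr => i _; rewrite /vadd; ring. Qed.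

Lemma dotZr n c (u v : vec n) : dot u (vscal c v) = c * dot u v.
Proof. by rewrite -rsumZ; apply: eq_bigr => i _; rewrite /vscal; ring. Qed.

Lemma dotDl n (u v w : vec n) : dot (vadd u v) w = dot u w + dot v w.
Proof. by rewrite !(dotC _ w) dotDr. Qed.

Lemma dotZl n c (u v : vec n) : dot (vscal c u) v = c * dot u v.
Proof. by rewrite !(dotC _ v) dotZr. Qed.

Lemma vsubE n (u v : vec n) : vsub u v = vadd u (vscal (-1) v).
Proof. by vext; ring. Qed.

Lemma voppE n (u : vec n) : vopp u = vscal (-1) u.
Proof. by vext; ring. Qed.

Lemma dotBr n (u v w : vec n) : dot u (vsub v w) = dot u v - dot u w.
Proof. by rewrite vsubE dotDr dotZr; ring. Qed.

Lemma dot0r n (u : vec n) : dot u (@vzero n) = 0.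
Proof. by apply: rsum_eq0 => i; rewrite /vzero; ring. Qed.

Lemma dot_ebasis n (u : vec n) j : dot u (ebasis j) = u j.
Proof. exact: rsum_delta. Qed.

Lemma dot_ext n (u v : vec n) : (forall w, dot u w = dot v w) -> u = v.
Proof.
by move=> uv; apply: functional_extensionality => j; rewrite -!dot_ebasis.
Qed.

Lemma dot_trmulmv s n (A : mat s n) (v : vec s) (u : vec n) :
  dot (trmulmv A v) u = dot v (mulmv A u).
Proof.
rewrite /dot /trmulmv /mulmv.
transitivity (\big[Rplus/0]_(j < n) \big[Rplus/0]_(i < s) (A i j * v i * u j)).
  by apply: eq_bigr => j _; rewrite rsumZr.
rewrite exchange_big; apply: eq_bigr => i _.
by rewrite /dot -rsumZ; apply: eq_bigr => j _; ring.
Qed.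

Lemma mulmvD s n (A : mat s n) u v : mulmv A (vadd u v) = vadd (mulmv A u) (mulmv A v).
Proof. by vext; rewrite /mulmv dotDr. Qed.

Lemma mulmvZ s n (A : mat s n) c u : mulmv A (vscal c u) = vscal c (mulmv A u).
Proof. by vext; rewrite /mulmv dotZr. Qed.

Lemma mulmvB s n (A : mat s n) u v : mulmv A (vsub u v) = vsub (mulmv A u) (mulmv A v).
Proof. by vext; rewrite /mulmv dotBr. Qed.

Lemma mulmv0 s n (A : mat s n) : mulmv A (@vzero n) = @vzero s.
Proof. by vext; rewrite /mulmv dot0r. Qed.

Lemma trmulmvD s n (A : mat s n) u v :
  trmulmv A (vadd u v) = vadd (trmulmv A u) (trmulmv A v).
Proof. by apply: dot_ext => w; rewrite dotDl !dot_trmulmv dotDl. Qed.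

Lemma trmulmvZ s n (A : mat s n) c u : trmulmv A (vscal c u) = vscal c (trmulmv A u).
Proof. by apply: dot_ext => w; rewrite dotZl !dot_trmulmv dotZl. Qed.

Lemma trmulmv0 s n (A : mat s n) : trmulmv A (@vzero s) = @vzero n.
Proof. by vext; rewrite /trmulmv rsum_eq0 // => j; ring. Qed.

Definition matmul d s n (A : mat d s) (B : mat s n) : mat d n :=
  fun i j => \big[Rplus/0]_(k < s) (A i k * B k j).

Lemma mulmv_matmul d s n (A : mat d s) (B : mat s n) u :
  mulmv (matmul A B) u = mulmv A (mulmv B u).
Proof.
vext; rewrite /mulmv /matmul /dot.
transitivity (\big[Rplus/0]_(j < n) \big[Rplus/0]_(k < s) (A i k * B k j * u j)).
  by apply: eq_bigr => j _; rewrite rsumZr.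
rewrite exchange_big; apply: eq_bigr => k _.
by rewrite /dot -rsumZ; apply: eq_bigr => j _; ring.
Qed.

Lemma trmulmv_matmul d s n (A : mat d s) (B : mat s n) u :
  trmulmv (matmul A B) u = trmulmv B (trmulmv A u).
Proof. by apply: dot_ext => w; rewrite !dot_trmulmv mulmv_matmul. Qed.

(** The l1 norm: estimates become sums over coordinates. It gives the same convergence as the
    Euclidean [vnorm], see [seq_cvgP]. *)
Definition nrm n (u : vec n) : R := \big[Rplus/0]_(i < n) Rabs (u i).

Lemma nrm_ge0 n (u : vec n) : 0 <= nrm u.
Proof. by apply: rsum_ge0 => i; exact: Rabs_pos. Qed.

Lemma nrmD n (u v : vec n) : nrm (vadd u v) <= nrm u + nrm v.
Proof. by rewrite -rsumD; apply: rsum_le => i; exact: Rabs_triang. Qed.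

Lemma nrmZ n c (u : vec n) : nrm (vscal c u) = Rabs c * nrm u.
Proof. by rewrite -rsumZ; apply: eq_bigr => i _; rewrite -Rabs_mult. Qed.

Lemma nrm0 n : nrm (@vzero n) = 0.
Proof. by apply: rsum_eq0 => i; exact: Rabs_R0. Qed.

Lemma nrmBC n (u v : vec n) : nrm (vsub u v) = nrm (vsub v u).
Proof. by apply: eq_bigr => i _; rewrite /vsub Rabs_minus_sym. Qed.

Lemma nrm_triangB n (u v w : vec n) : nrm (vsub u w) <= nrm (vsub u v) + nrm (vsub v w).
Proof.
have -> : vsub u w = vadd (vsub u v) (vsub v w) by vext; ring.
exact: nrmD.
Qed.

Lemma nrm_le n (u v : vec n) : nrm u <= nrm v + nrm (vsub u v).
Proof.
have {1}-> : u = vadd v (vsub u v) by vext; ring.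
exact: nrmD.
Qed.

Lemma coord_le_nrm n (u : vec n) i : Rabs (u i) <= nrm u.
Proof. by apply: (@le_rsum _ (fun i => Rabs (u i))) => j; exact: Rabs_pos. Qed.

Lemma dot_ge0 n (u : vec n) : 0 <= dot u u.
Proof. by apply: rsum_ge0 => i; nra. Qed.

Lemma vnorm_le_nrm n (u : vec n) : vnorm u <= nrm u.
Proof.
rewrite /vnorm -(sqrt_Rsqr (nrm u)); last exact: nrm_ge0.
apply: sqrt_le_1; [exact: dot_ge0|exact: Rle_0_sqr|].
rewrite /dot /Rsqr {1}/nrm -rsumZr; apply: rsum_le => i.
have -> : u i * u i = Rabs (u i) * Rabs (u i).
  by rewrite -Rabs_mult Rabs_pos_eq //; nra.
by apply: Rmult_le_compat_l; [exact: Rabs_pos|exact: coord_le_nrm].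
Qed.

Lemma coord_le_vnorm n (u : vec n) i : Rabs (u i) <= vnorm u.
Proof.
rewrite -sqrt_Rsqr_abs; apply: sqrt_le_1; [exact: Rle_0_sqr|exact: dot_ge0|].
by apply: (@le_rsum _ (fun i => u i * u i)) => j; nra.
Qed.

Definition mnrm s n (A : mat s n) : R := \big[Rplus/0]_(i < s) nrm (A i).

Lemma mnrm_ge0 s n (A : mat s n) : 0 <= mnrm A.
Proof. by apply: rsum_ge0 => i; exact: nrm_ge0. Qed.

Lemma Rabs_dot_le n (u v : vec n) : Rabs (dot u v) <= nrm u * nrm v.
Proof.
apply: Rle_trans (Rabs_rsum _) _; rewrite {1}/nrm -rsumZr; apply: rsum_le => i.
rewrite Rabs_mult; apply: Rmult_le_compat_l; [exact: Rabs_pos|exact: coord_le_nrm].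
Qed.

Lemma nrm_mulmv_le s n (A : mat s n) u : nrm (mulmv A u) <= mnrm A * nrm u.
Proof. by rewrite {1}/nrm /mnrm -rsumZr; apply: rsum_le => i; exact: Rabs_dot_le. Qed.

(** Lifts exist only once a sequence is close to its limit, so properties along sequences are
    required eventually. [tangent_coneP] and [lim_normal_dirP] return to the form valid at every
    index. *)
Definition ev (P : nat -> Prop) : Prop := exists N, forall k, leq N k -> P k.

Lemma ev_and P Q : ev P -> ev Q -> ev (fun k => P k /\ Q k).
Proof.
move=> [N HN] [M HM]; exists (maxn N M) => k; rewrite geq_max => /andP [? ?].
by split; [exact: HN|exact: HM].
Qed.

Lemma ev_mono (P Q : nat -> Prop) : (forall k, P k -> Q k) -> ev P -> ev Q.
Proof. by move=> PQ [N HN]; exists N => k /HN /PQ. Qed.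

Lemma ev_all (P : nat -> Prop) : (forall k, P k) -> ev P.
Proof. by exists O. Qed.

Lemma ev_choice n (P : nat -> vec n -> Prop) :
  ev (fun k => exists y, P k y) -> exists y : nat -> vec n, ev (fun k => P k (y k)).
Proof.
(* At the finitely many indices below [N] the value may be arbitrary; eventual properties do not see
   it. *)
move=> [N HN]; exists (fun k => epsilon (inhabits (@vzero n)) (P k)).
by exists N => k Nk; apply: epsilon_spec; exact: HN.
Qed.

Lemma Un_cvP u l : Un_cv u l <-> forall eps, 0 < eps -> ev (fun k => Rabs (u k - l) < eps).
Proof.
split=> H eps e0; have [N HN] := H eps e0; exists N => k.
  by move=> /leP; exact: HN.
by move=> Nk; apply: HN; apply/leP.
Qed.

Lemma Un_cv_ext_ev u v l : ev (fun k => u k = v k) -> Un_cv u l -> Un_cv v l.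
Proof.
move=> uv /Un_cvP ul; apply/Un_cvP => eps e0.
by apply: ev_mono (ev_and uv (ul eps e0)) => k [<-].
Qed.

Lemma Un_cv_eq u v l : (forall k, u k = v k) -> Un_cv u l -> Un_cv v l.
Proof. by move=> uv; apply: Un_cv_ext_ev; exact: ev_all. Qed.

Lemma Un_cv_squeeze u v l : ev (fun k => Rabs (u k - l) <= v k) -> Un_cv v 0 -> Un_cv u l.
Proof.
move=> uv /Un_cvP v0; apply/Un_cvP => eps e0.
apply: ev_mono (ev_and uv (v0 eps e0)) => k [].
by have := Rle_abs (v k - 0); lra.
Qed.

Lemma Un_cv_cst c : Un_cv (fun=> c) c.
Proof. by apply/Un_cvP => eps e0; apply: ev_all => k; rewrite Rminus_diag Rabs_R0. Qed.

Lemma Un_cv_lt u l c : Un_cv u l -> l < c -> ev (fun k => u k < c).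
Proof.
move=> /Un_cvP ul lc; have e0 : 0 < c - l by lra.
by apply: ev_mono (ul _ e0) => k; have := Rle_abs (u k - l); lra.
Qed.

Lemma Un_cv_rsum n (u : nat -> 'I_n -> R) l :
  (forall i, Un_cv (fun k => u k i) (l i)) ->
  Un_cv (fun k => rsum n (u k)) (rsum n l).
Proof.
move=> ul; elim: (index_enum _) => [|i r IH].
  by apply: (@Un_cv_eq (fun=> 0)) => [k|]; rewrite big_nil //; exact: Un_cv_cst.
rewrite big_cons; apply: (@Un_cv_eq (fun k => u k i + \big[Rplus/0]_(j <- r) u k j)) => [k|].
  by rewrite big_cons.
exact: CV_plus.
Qed.

Definition vlim n (x : nat -> vec n) (a : vec n) :=
  forall i, Un_cv (fun k => x k i) (a i).

Definition mlim s n (x : nat -> mat s n) (a : mat s n) := forall i, vlim (x^~ i) (a i).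

Lemma Un_cv_mnrm s n (A : nat -> mat s n) B :
  mlim A B -> Un_cv (fun k => mnrm (A k)) (mnrm B).
Proof.
move=> AB; apply: (@Un_cv_rsum _ (fun k i => nrm (A k i))) => i.
apply: (@Un_cv_rsum _ (fun k j => Rabs (A k i j))) => j.
exact: cv_cvabs (AB i j).
Qed.

Lemma vlim_ext_ev n (x y : nat -> vec n) a :
  ev (fun k => x k = y k) -> vlim x a -> vlim y a.
Proof.
by move=> xy xa i; apply: Un_cv_ext_ev (xa i); apply: ev_mono xy => k ->.
Qed.

Lemma vlim_cst n (a : vec n) : vlim (fun=> a) a.
Proof. by move=> i; exact: Un_cv_cst. Qed.

Lemma vlimD n (x y : nat -> vec n) a b :
  vlim x a -> vlim y b -> vlim (fun k => vadd (x k) (y k)) (vadd a b).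
Proof. by move=> xa yb i; exact: CV_plus. Qed.

Lemma vlimB n (x y : nat -> vec n) a b :
  vlim x a -> vlim y b -> vlim (fun k => vsub (x k) (y k)) (vsub a b).
Proof. by move=> xa yb i; exact: CV_minus. Qed.

Lemma vlimZ n t (x : nat -> vec n) c a :
  Un_cv t c -> vlim x a -> vlim (fun k => vscal (t k) (x k)) (vscal c a).
Proof. by move=> tc xa i; exact: CV_mult. Qed.

Lemma Un_cv_dot n (x y : nat -> vec n) a b :
  vlim x a -> vlim y b -> Un_cv (fun k => dot (x k) (y k)) (dot a b).
Proof.
move=> xa yb; apply: (@Un_cv_rsum _ (fun k i => x k i * y k i)) => i; exact: CV_mult.
Qed.

Lemma vlim_mulmv s n (A : nat -> mat s n) (x : nat -> vec n) B a :
  mlim A B -> vlim x a -> vlim (fun k => mulmv (A k) (x k)) (mulmv B a).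
Proof. by move=> AB xa i; exact: (Un_cv_dot (AB i)). Qed.

Lemma vlim_trmulmv s n (A : nat -> mat s n) (x : nat -> vec s) B a :
  mlim A B -> vlim x a -> vlim (fun k => trmulmv (A k) (x k)) (trmulmv B a).
Proof.
move=> AB xa j; apply: (@Un_cv_rsum _ (fun k i => A k i j * x k i)) => i.
by apply: CV_mult; [exact: AB|exact: xa].
Qed.

Lemma mlim_matmul d s n (A : nat -> mat d s) (x : nat -> mat s n) B a :
  mlim A B -> mlim x a -> mlim (fun k => matmul (A k) (x k)) (matmul B a).
Proof.
move=> AB xa i j; apply: (@Un_cv_rsum _ (fun k l => A k i l * x k l j)) => l.
by apply: CV_mult; [exact: AB|exact: xa].
Qed.

Lemma mlim_cst s n (A : mat s n) : mlim (fun=> A) A.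
Proof. by move=> i j; exact: Un_cv_cst. Qed.

Lemma vlim_nrm n (x : nat -> vec n) a :
  vlim x a <-> Un_cv (fun k => nrm (vsub (x k) a)) 0.
Proof.
split=> [xa|x0 i].
  have -> : 0 = \big[Rplus/0]_(i < n) 0 by rewrite rsum_eq0.
  apply: (@Un_cv_rsum _ (fun k i => Rabs (vsub (x k) a i)) (fun=> 0)) => i.
  rewrite -Rabs_R0; apply: cv_cvabs; rewrite -(Rminus_diag (a i)).
  by apply: CV_minus (xa i) (Un_cv_cst _).
apply: Un_cv_squeeze x0; apply: ev_all => k.
exact: (coord_le_nrm (vsub (x k) a) i).
Qed.

Lemma vlim_squeeze n (x : nat -> vec n) a v :
  ev (fun k => nrm (vsub (x k) a) <= v k) -> Un_cv v 0 -> vlim x a.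
Proof.
move=> xv v0; apply/vlim_nrm; apply: Un_cv_squeeze v0; apply: ev_mono xv => k.
by rewrite Rminus_0_r Rabs_pos_eq //; exact: nrm_ge0.
Qed.

Lemma vlim_bound n (x : nat -> vec n) a :
  vlim x a -> ev (fun k => nrm (x k) <= nrm a + 1).
Proof.
move=> /vlim_nrm xa; apply: ev_mono (Un_cv_lt xa Rlt_0_1) => k.
by have := nrm_le (x k) a; lra.
Qed.

Lemma seq_cvgP n (x : nat -> vec n) a : seq_cvg x a <-> vlim x a.
Proof.
split=> [xa i|/vlim_nrm xa eps e0].
  apply/Un_cvP => eps e0; have [N HN] := xa eps e0; exists N => k /HN.
  by have := coord_le_vnorm (vsub (x k) a) i; rewrite {1}/vsub; lra.
have [N HN] := Un_cv_lt xa e0; exists N => k /HN.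
by have := vnorm_le_nrm (vsub (x k) a); lra.
Qed.

Lemma vlim_small n (t : nat -> R) (x : nat -> vec n) a y :
  Un_cv t 0 -> vlim x a -> vlim (fun k => vadd y (vscal (t k) (x k))) y.
Proof.
move=> t0 xa; have {2}-> : y = vadd y (vscal 0 a) by vext; ring.
by apply: vlimD (vlim_cst _) (vlimZ t0 xa).
Qed.

Lemma Un_cv_bounded0 (u v : nat -> R) C :
  ev (fun k => Rabs (v k) <= C) -> Un_cv u 0 -> Un_cv (fun k => u k * v k) 0.
Proof.
move=> vC u0; have C0 : Un_cv (fun k => Rabs (u k) * C) 0.
  rewrite -(Rmult_0_l C) -Rabs_R0; apply: CV_mult (cv_cvabs _ _ u0) (Un_cv_cst _).
apply: Un_cv_squeeze C0; apply: ev_mono vC => k vC.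
rewrite Rminus_0_r Rabs_mult; apply: Rmult_le_compat_l => //; exact: Rabs_pos.
Qed.

(** * Right inverses and transposes *)

Lemma tr_right_inv d n (F : mat d n) (Q : mat n d) :
  (forall v, mulmv F (mulmv Q v) = v) -> forall a, trmulmv Q (trmulmv F a) = a.
Proof. by move=> FQ a; apply: dot_ext => w; rewrite !dot_trmulmv FQ. Qed.

(** The orthogonal complement of the kernel is the range of the transpose. The right inverse makes
    it explicit, because w - Q F w always lies in the kernel. *)
Lemma tr_kernel_range d n (F : mat d n) (Q : mat n d) v :
  (forall v, mulmv F (mulmv Q v) = v) ->
  (forall u, mulmv F u = @vzero d -> dot v u = 0) ->
  v = trmulmv F (trmulmv Q v).
Proof.
move=> FQ vker; apply: dot_ext => w; rewrite !dot_trmulmv.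
have := vker (vsub w (mulmv Q (mulmv F w))).
rewrite dotBr mulmvB FQ => H; suff : dot v w - dot v (mulmv Q (mulmv F w)) = 0 by lra.
by apply: H; vext; ring.
Qed.

(* F_k Q tends to the identity, so the combination (F_k)^T a_k controls a_k. *)
Lemma trmulmv_lim_inv d n (F : nat -> mat d n) (F0 : mat d n) (Q : mat n d)
    (a : nat -> vec d) y :
  (forall v, mulmv F0 (mulmv Q v) = v) -> mlim F F0 ->
  vlim (fun k => trmulmv (F k) (a k)) y ->
  vlim a (trmulmv Q y).
Proof.
move=> FQ FF0 Fa.
(* [E k] is the transpose of I - F_k Q, so that a_k = b_k + E_k a_k with [b] convergent and [E]
   tending to 0. *)
pose E k : mat d d := fun i j => ebasis i j - matmul (F k) Q j i.
pose b k := trmulmv Q (trmulmv (F k) (a k)).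
have bE k : vsub (a k) (b k) = mulmv (E k) (a k).
  rewrite /b -trmulmv_matmul vsubE; vext.
  rewrite /mulmv /dot /trmulmv -[a k i](rsum_delta (a k)) -rsumZ -rsumD.
  by apply: eq_bigr => j _; rewrite /E /ebasis eq_sym; ring.
have E0 : Un_cv (fun k => mnrm (E k)) 0.
  have -> : 0 = mnrm (fun i j : 'I_d => 0) by rewrite /mnrm rsum_eq0 // => i; exact: nrm0.
  apply: Un_cv_mnrm => i j; rewrite -(Rminus_diag (ebasis i j)).
  apply: CV_minus (Un_cv_cst _) _.
  have -> : ebasis i j = matmul F0 Q j i.
    rewrite -[RHS](rsum_delta (fun i => matmul F0 Q j i)).
    have := congr1 (fun u : vec d => u j) (FQ (ebasis i)).
    by rewrite -mulmv_matmul /mulmv /dot /ebasis eq_sym => ->.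
  exact: mlim_matmul FF0 (mlim_cst _) j i.
have bl : vlim b (trmulmv Q y) := vlim_trmulmv (mlim_cst Q) Fa.
(* Once [mnrm (E k)] is below 1/2, the term E_k a_k is absorbed into the left side and a_k is at
   most twice b_k in norm. *)
have ab : ev (fun k => nrm (a k) <= 2 * (nrm (trmulmv Q y) + 1)).
  have e2 : 0 < / 2 by lra.
  apply: ev_mono (ev_and (vlim_bound bl) (Un_cv_lt E0 e2)) => k [bk Ek].
  have := nrm_le (a k) (b k); rewrite bE.
  have := nrm_mulmv_le (E k) (a k); have := nrm_ge0 (a k); nra.
have Ea : vlim (fun k => mulmv (E k) (a k)) (@vzero d).
  have C0 := @Un_cv_bounded0 _ (fun k => nrm (a k)) (2 * (nrm (trmulmv Q y) + 1)) _ E0.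
  apply: vlim_squeeze (C0 _) => [|].
    apply: ev_all => k; have -> : vsub (mulmv (E k) (a k)) (@vzero d) = mulmv (E k) (a k).
      by vext; ring.
    exact: nrm_mulmv_le.
  by apply: ev_mono ab => k; rewrite Rabs_pos_eq //; exact: nrm_ge0.
have -> : trmulmv Q y = vadd (trmulmv Q y) (@vzero d) by vext; ring.
apply: vlim_ext_ev (vlimD bl Ea); apply: ev_all => k.
by rewrite -bE; vext; ring.
Qed.

(** * Strict differentiability *)

Lemma finite_min n (P : 'I_n -> R -> Prop) :
  (forall i d d', d' <= d -> P i d -> P i d') ->
  (forall i, exists d, 0 < d /\ P i d) ->
  exists d, 0 < d /\ forall i, P i d.
Proof.
move=> Pmono H.
have D i : {d | 0 < d /\ P i d} by exact: constructive_indefinite_description (H i).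
(* The radius 1 / (1 + S) lies below every chosen radius and is positive even for n = 0. *)
pose S := \big[Rplus/0]_(i < n) / sval (D i).
have pos i : 0 <= / sval (D i) by apply/Rlt_le/Rinv_0_lt_compat; case: (svalP (D i)).
have S0 : 0 <= S by exact: rsum_ge0.
exists (/ (1 + S)); split=> [|i]; first by apply: Rinv_0_lt_compat; lra.
have [di Pi] := svalP (D i); apply: Pmono Pi.
rewrite -(Rinv_inv (sval (D i))); apply: Rinv_le_contravar.
  exact: Rinv_0_lt_compat.
have := le_rsum i pos; rewrite -/S; lra.
Qed.

Definition near2 n (x : vec n) (P : vec n -> vec n -> Prop) :=
  exists d, 0 < d /\ forall y z, nrm (vsub y x) < d -> nrm (vsub z x) < d -> P y z.

Lemma near2_and n (x : vec n) P Q :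
  near2 x P -> near2 x Q -> near2 x (fun y z => P y z /\ Q y z).
Proof.
move=> [d [d0 HP]] [e [e0 HQ]]; exists (Rmin d e); split; first exact: Rmin_pos.
by move=> y z /Rmin_Rgt [? ?] /Rmin_Rgt [? ?]; split; [exact: HP|exact: HQ].
Qed.

Lemma near2_mono n (x : vec n) (P Q : vec n -> vec n -> Prop) :
  (forall y z, P y z -> Q y z) -> near2 x P -> near2 x Q.
Proof. by move=> PQ [d [d0 H]]; exists d; split=> // y z *; apply/PQ/H. Qed.

Lemma near2_forall n m (x : vec n) (P : 'I_m -> vec n -> vec n -> Prop) :
  (forall i, near2 x (P i)) -> near2 x (fun y z => forall i, P i y z).
Proof.
move=> H; have [|d [d0 Hd]] := @finite_min m (fun i d =>
  forall y z, nrm (vsub y x) < d -> nrm (vsub z x) < d -> P i y z) _ H.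
  by move=> i d d' d'd Pd y z ? ?; apply: Pd; lra.
by exists d; split=> // y z *; apply: Hd.
Qed.

Definition vcont n (f : vec n -> R) (x : vec n) :=
  forall eps, 0 < eps -> exists d, 0 < d /\
    forall y, nrm (vsub y x) < d -> Rabs (f y - f x) < eps.

(** Strict differentiability with gradient [a]: both points move, which yields local Lipschitz
    bounds and the contraction estimate in [lift_sequence]. *)
Definition sdiff n (f : vec n -> R) (x a : vec n) := forall eps, 0 < eps ->
  near2 x (fun y z => Rabs (f y - f z - dot a (vsub y z)) <= eps * nrm (vsub y z)).

Lemma nrm_subxx n (x : vec n) : nrm (vsub x x) = 0.
Proof. by apply: rsum_eq0 => i; rewrite /vsub Rminus_diag Rabs_R0. Qed.

Lemma vcontP n (f : vec n -> R) x : vcontinuous f -> vcont f x.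
Proof.
move=> fc eps e0; have [d [d0 H]] := fc x eps e0; exists d; split=> // y yx.
by apply: H; apply: Rle_lt_trans yx; exact: vnorm_le_nrm.
Qed.

Lemma vcont_lim n (f : vec n -> R) x (X : nat -> vec n) :
  vcont f x -> vlim X x -> Un_cv (fun k => f (X k)) (f x).
Proof.
move=> fc /vlim_nrm Xx; apply/Un_cvP => eps /fc [d [d0 H]].
by apply: ev_mono (Un_cv_lt Xx d0) => k; exact: H.
Qed.

Lemma sdiff_lip n (f : vec n -> R) x a : sdiff f x a ->
  near2 x (fun y z => Rabs (f y - f z) <= (nrm a + 1) * nrm (vsub y z)).
Proof.
move=> fa; apply: near2_mono (fa 1 Rlt_0_1) => y z H.
have := Rabs_dot_le a (vsub y z).
have := Rabs_triang (f y - f z - dot a (vsub y z)) (dot a (vsub y z)).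
have -> : f y - f z - dot a (vsub y z) + dot a (vsub y z) = f y - f z by ring.
lra.
Qed.

Lemma sdiff_cont n (f : vec n -> R) x a : sdiff f x a -> vcont f x.
Proof.
move=> /sdiff_lip [d [d0 H]] eps e0; have a0 := nrm_ge0 a.
exists (Rmin d (eps / (nrm a + 1))); split=> [|y /Rmin_Rgt [yd ye]].
  by apply: Rmin_pos => //; apply: Rdiv_lt_0_compat; lra.
apply: Rle_lt_trans (H y x yd _) _; first by rewrite nrm_subxx.
have -> : eps = (nrm a + 1) * (eps / (nrm a + 1)) by field; lra.
by apply: Rmult_lt_compat_l ye; lra.
Qed.

Lemma near2_cont n (f : vec n -> R) x eps : vcont f x -> 0 < eps ->
  near2 x (fun y z => Rabs (f y - f x) < eps /\ Rabs (f z - f x) < eps).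
Proof.
move=> fc /fc [d [d0 H]]; exists d; split=> // y z yx zx.
by split; apply: H.
Qed.

(** The directions [u k] may vary with the step, as they do in tangent sequences. *)
Lemma sdiff_quotient n (f : vec n -> R) x a t u d :
  sdiff f x a -> (forall k, 0 < t k) -> Un_cv t 0 -> vlim u d ->
  Un_cv (fun k => (f (vadd x (vscal (t k) (u k))) - f x) / t k) (dot a d).
Proof.
move=> fa t0 tl ul.
suff H : Un_cv (fun k => (f (vadd x (vscal (t k) (u k))) - f x) / t k - dot a (u k)) 0.
  have := CV_plus _ _ _ _ H (Un_cv_dot (vlim_cst a) ul); rewrite Rplus_0_l.
  by apply: Un_cv_eq => k; ring.
apply/Un_cvP => eps e0; have d0 := nrm_ge0 d.
(* Eventually [nrm (u k)] is at most [nrm d + 1]; the further unit makes the final inequality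
   strict. *)
have c0 : 0 < eps / (nrm d + 2) by apply: Rdiv_lt_0_compat; lra.
have [r [r0 H]] := fa _ c0.
have xl := vlim_small x tl ul.
apply: ev_mono (ev_and (Un_cv_lt ((vlim_nrm _ _).1 xl) r0) (vlim_bound ul)) => k [xr uk].
have {H} := H _ x xr; rewrite nrm_subxx => /(_ r0).
have -> : vsub (vadd x (vscal (t k) (u k))) x = vscal (t k) (u k) by vext; ring.
rewrite nrmZ dotZr (Rabs_pos_eq (t k)); last exact/Rlt_le.
have tk := t0 k; rewrite Rminus_0_r.
set A := f _ - f x => H.
have -> : A / t k - dot a (u k) = (A - t k * dot a (u k)) * / t k by field; lra.
rewrite Rabs_mult (Rabs_pos_eq (/ t k)); last exact/Rlt_le/Rinv_0_lt_compat.
apply: (Rle_lt_trans _ (eps / (nrm d + 2) * (t k * nrm (u k)) * / t k)).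
  by apply: Rmult_le_compat_r H; exact/Rlt_le/Rinv_0_lt_compat.
have -> : eps / (nrm d + 2) * (t k * nrm (u k)) * / t k = eps / (nrm d + 2) * nrm (u k).
  by field; lra.
have {2}-> : eps = eps / (nrm d + 2) * (nrm d + 2) by field; lra.
by apply: Rmult_lt_compat_l; lra.
Qed.

Lemma sdiff_cst n c (x : vec n) : sdiff (fun=> c) x (@vzero n).
Proof.
move=> eps e0; exists 1; split; first lra; move=> y z _ _.
rewrite dotC dot0r !Rminus_diag Rabs_R0; have := nrm_ge0 (vsub y z); nra.
Qed.

Lemma sdiffD n (f g : vec n -> R) x a b : sdiff f x a -> sdiff g x b ->
  sdiff (fun y => f y + g y) x (vadd a b).
Proof.
move=> fa gb eps e0; have e2 : 0 < eps / 2 by lra.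
apply: near2_mono (near2_and (fa _ e2) (gb _ e2)) => y z [H1 H2].
rewrite dotDl.
have -> : f y + g y - (f z + g z) - (dot a (vsub y z) + dot b (vsub y z)) =
  (f y - f z - dot a (vsub y z)) + (g y - g z - dot b (vsub y z)) by ring.
by apply: Rle_trans (Rabs_triang _ _) _; lra.
Qed.

Lemma sdiff_rsum n m (f : 'I_m -> vec n -> R) x a : (forall i, sdiff (f i) x (a i)) ->
  sdiff (fun y => \big[Rplus/0]_(i < m) f i y) x (fun j => \big[Rplus/0]_(i < m) a i j).
Proof.
move=> fa; elim: (index_enum _) => [|i r IH].
  have -> : (fun y => \big[Rplus/0]_(i <- [::]) f i y) = fun=> 0.
    by apply: functional_extensionality => y; rewrite big_nil.
  have -> : (fun j => \big[Rplus/0]_(i <- [::]) a i j) = @vzero n.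
    by vext; rewrite big_nil.
  exact: sdiff_cst.
have -> : (fun y => \big[Rplus/0]_(j <- i :: r) f j y) =
          fun y => f i y + \big[Rplus/0]_(j <- r) f j y.
  by apply: functional_extensionality => y; rewrite big_cons.
have -> : (fun l => \big[Rplus/0]_(j <- i :: r) a j l) =
          vadd (a i) (fun l => \big[Rplus/0]_(j <- r) a j l).
  by vext; rewrite big_cons.
exact: sdiffD.
Qed.

Lemma sdiffM n (f g : vec n -> R) x a b : sdiff f x a -> sdiff g x b ->
  sdiff (fun y => f y * g y) x (vadd (vscal (g x) a) (vscal (f x) b)).
Proof.
move=> fa gb eps e0.
(* [M] is the sum of the coefficients of the four error terms below; the 2 comes from the two
   Lipschitz constants [nrm a + 1] and [nrm b + 1]. *)
pose M := Rabs (f x) + Rabs (g x) + nrm a + nrm b + 2.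
have [fx0 gx0 a0 b0] : [/\ 0 <= Rabs (f x), 0 <= Rabs (g x), 0 <= nrm a & 0 <= nrm b].
  by split; try exact: Rabs_pos; exact: nrm_ge0.
have c0 : 0 < eps / (2 * M) by apply: Rdiv_lt_0_compat => //; rewrite /M; lra.
apply: near2_mono (near2_and (near2_and (fa _ c0) (gb _ c0)) (near2_and
  (near2_and (sdiff_lip fa) (sdiff_lip gb)) (near2_and
  (near2_cont (sdiff_cont fa) c0) (near2_cont (sdiff_cont gb) c0)))).
move=> y z [[H1 H2] [[H3 H4] [[H5 H6] [H7 H8]]]].
rewrite dotDl !dotZl; set N := nrm (vsub y z) in H1 H2 H3 H4 *.
have N0 : 0 <= N := nrm_ge0 _; set c := eps / (2 * M) in H1 H2 H5 H6 H7 H8 c0.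
have -> : f y * g y - f z * g z - (g x * dot a (vsub y z) + f x * dot b (vsub y z)) =
  (f y - f z - dot a (vsub y z)) * g x + (f y - f z) * (g y - g x) +
  (f x * (g y - g z - dot b (vsub y z)) + (f z - f x) * (g y - g z)) by ring.
have mulb p q P Q : Rabs p <= P -> Rabs q <= Q -> Rabs (p * q) <= P * Q.
  by move=> pP qQ; rewrite Rabs_mult; apply: Rmult_le_compat => //; exact: Rabs_pos.
have B1 := mulb _ _ _ _ H1 (Rle_refl (Rabs (g x))).
have B2 := mulb _ _ _ _ H3 (Rlt_le _ _ H7).
have B3 := mulb _ _ _ _ (Rle_refl (Rabs (f x))) H2.
have B4 := mulb _ _ _ _ (Rlt_le _ _ H6) H4.
apply: Rle_trans (Rabs_triang _ _) _.
have T1 := Rabs_triang ((f y - f z - dot a (vsub y z)) * g x) ((f y - f z) * (g y - g x)).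
have T2 := Rabs_triang (f x * (g y - g z - dot b (vsub y z))) ((f z - f x) * (g y - g z)).
have E : eps * N = 2 * M * (c * N) by rewrite /c /M; field; lra.
rewrite E; have cN : 0 <= c * N by nra.
have : M * (c * N) = c * N * Rabs (g x) + (nrm a + 1) * N * c + Rabs (f x) * (c * N) +
  c * ((nrm b + 1) * N) by rewrite /M; ring.
have M0 : 0 <= M by rewrite /M; lra.
nra.
Qed.

Lemma rsum_cst n c : \big[Rplus/0]_(i < n) c = INR n * c.
Proof.
elim: n => [|n IH]; first by rewrite big_ord0 /=; ring.
by rewrite big_ord_recr IH S_INR /=; ring.
Qed.

Lemma sdiff_vec n s (g : vec n -> vec s) x (G : mat s n) :
  (forall i, sdiff (fun y => g y i) x (G i)) -> forall eps, 0 < eps ->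
  near2 x (fun y z =>
    nrm (vsub (vsub (g y) (g z)) (mulmv G (vsub y z))) <= eps * nrm (vsub y z)).
Proof.
move=> gG eps e0; have s0 := pos_INR s.
have c0 : 0 < eps / (INR s + 1) by apply: Rdiv_lt_0_compat; lra.
apply: near2_mono (near2_forall (fun i => gG i _ c0)) => y z H.
apply: Rle_trans (rsum_le (fun i => H i)) _.
rewrite rsum_cst; have N0 := nrm_ge0 (vsub y z).
have {2}-> : eps = eps / (INR s + 1) * (INR s + 1) by field; lra.
nra.
Qed.

Lemma sdiff_comp n s (h : vec s -> R) (g : vec n -> vec s) x b (G : mat s n) :
  sdiff h (g x) b -> (forall i, sdiff (fun y => g y i) x (G i)) ->
  sdiff (fun y => h (g y)) x (trmulmv G b).
Proof.
move=> hb gG eps e0; have b0 := nrm_ge0 b; have G0 := mnrm_ge0 G.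
(* The error of [h] is multiplied by the Lipschitz constant [mnrm G + 1] of [g], the error of [g] by
   [nrm b]. *)
have c0 : 0 < eps / (mnrm G + 1 + nrm b) by apply: Rdiv_lt_0_compat; lra.
set c := eps / _ in c0.
have [d [d0 Hd]] := hb _ c0.
have near2_g : near2 x (fun y z => nrm (vsub (g y) (g x)) < d /\ nrm (vsub (g z) (g x)) < d).
  have [r [r0 H]] := sdiff_vec gG Rlt_0_1.
  exists (Rmin r (d / (mnrm G + 1))); split.
    by apply: Rmin_pos => //; apply: Rdiv_lt_0_compat; lra.
  have gd y : nrm (vsub y x) < Rmin r (d / (mnrm G + 1)) -> nrm (vsub (g y) (g x)) < d.
    move=> /Rmin_Rgt [yr yd]; have := H y x yr; rewrite nrm_subxx => /(_ r0).
    have := nrm_le (vsub (g y) (g x)) (mulmv G (vsub y x)).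
    have := nrm_mulmv_le G (vsub y x).
    have -> : d = (mnrm G + 1) * (d / (mnrm G + 1)) by field; lra.
    have : (mnrm G + 1) * nrm (vsub y x) < (mnrm G + 1) * (d / (mnrm G + 1)).
      by apply: Rmult_lt_compat_l => //; lra.
    lra.
  by move=> y z yx zx; split; exact: gd.
apply: near2_mono (near2_and (near2_and near2_g (sdiff_vec gG c0)) (sdiff_vec gG Rlt_0_1)).
move=> y z [[[gy gz] Hc] H1]; have {}Hd := Hd _ _ gy gz.
rewrite dot_trmulmv; set N := nrm (vsub y z) in Hc H1 *; have N0 : 0 <= N := nrm_ge0 _.
have -> : h (g y) - h (g z) - dot b (mulmv G (vsub y z)) =
  (h (g y) - h (g z) - dot b (vsub (g y) (g z))) +
  dot b (vsub (vsub (g y) (g z)) (mulmv G (vsub y z))) by rewrite !dotBr; ring.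
apply: Rle_trans (Rabs_triang _ _) _.
have := Rabs_dot_le b (vsub (vsub (g y) (g z)) (mulmv G (vsub y z))).
have := nrm_le (vsub (g y) (g z)) (mulmv G (vsub y z)).
have := nrm_mulmv_le G (vsub y z); rewrite -/N.
set A := nrm (vsub (vsub (g y) (g z)) (mulmv G (vsub y z))) in Hc H1 *.
move=> B1 B2 B3.
have E : eps = c * (mnrm G + 1 + nrm b) by rewrite /c; field; lra.
have : nrm b * A <= nrm b * (c * N) by apply: Rmult_le_compat_l.
have : c * nrm (vsub (g y) (g z)) <= c * ((mnrm G + 1) * N).
  by apply: Rmult_le_compat_l; lra.
rewrite E; lra.
Qed.

(** [is_partial] differentiates at parameter 0 of a line through the point, while the mean value
    theorem needs derivatives at all parameters of one fixed line. *)
Lemma shift_partial n (f : vec n -> R) j p t0 l :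
  is_partial f j (vadd p (vscal t0 (ebasis j))) l ->
  derivable_pt_lim (fun t => f (vadd p (vscal t (ebasis j)))) t0 l.
Proof.
move=> H eps /H [d Hd]; exists d => k k0 kd; have := Hd k k0 kd.
rewrite Rplus_0_l.
have -> : vadd (vadd p (vscal t0 (ebasis j))) (vscal k (ebasis j)) =
  vadd p (vscal (t0 + k) (ebasis j)) by vext; ring.
by have -> : vadd (vadd p (vscal t0 (ebasis j))) (vscal 0 (ebasis j)) =
  vadd p (vscal t0 (ebasis j)) by vext; ring.
Qed.

Lemma telescope_rsum (a : nat -> R) n :
  \big[Rplus/0]_(j < n) (a j.+1 - a j) = a n - a O.
Proof.
elim: n => [|n IH]; first by rewrite big_ord0; ring.
by rewrite big_ord_recr /= IH; ring.
Qed.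

Lemma sdiff_of_partials n (f : vec n -> R) (df : 'I_n -> vec n -> R) x :
  (forall j y, is_partial f j y (df j y)) -> (forall j, vcont (df j) x) ->
  sdiff f x (df^~ x).
Proof.
move=> fdf dfc eps e0.
have [|d [d0 Hd]] := @finite_min n (fun j d =>
    forall y, nrm (vsub y x) < d -> Rabs (df j y - df j x) < eps) _
    (fun j => dfc j eps e0).
  by move=> i d d' d'd Pd y ?; apply: Pd; lra.
(* The intermediate points used below are no farther from [x] than the distances of [y] and [z]
   added together, hence half the radius. *)
exists (d / 2); split=> [|y z yx zx]; first lra.
(* The first [m] coordinates come from [y], the others from [z]. Consecutive hybrids differ in one
   coordinate, so f y - f z telescopes into one-dimensional increments. *)
pose hyb (m : nat) : vec n := fun i => if leq (i.+1) m then y i else z i.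
have -> : f y = f (hyb n).
  by congr f; apply: functional_extensionality => i; rewrite /hyb ltn_ord.
have -> : f z = f (hyb O) by [].
rewrite -(telescope_rsum (fun m => f (hyb m))) /dot.
have -> : \big[Rplus/0]_(j < n) (f (hyb j.+1) - f (hyb j)) -
    \big[Rplus/0]_(j < n) (df j x * vsub y z j) =
    \big[Rplus/0]_(j < n) (f (hyb j.+1) - f (hyb j) - df j x * vsub y z j).
  transitivity (\big[Rplus/0]_(j < n) (f (hyb j.+1) - f (hyb j)) +
      \big[Rplus/0]_(j < n) (-1 * (df j x * vsub y z j))); first by rewrite rsumZ; ring.
  by rewrite -rsumD; apply: eq_bigr => j _; ring.
apply: Rle_trans (Rabs_rsum _) _; rewrite /nrm -rsumZ; apply: rsum_le => j.
pose b := vsub y z j.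
have -> : hyb j.+1 = vadd (hyb j) (vscal b (ebasis j)).
  vext; rewrite /hyb /ebasis ltnS leq_eqVlt; case: eqVneq => [ij|ij].
    have -> : i = j by exact: val_inj.
    by rewrite ltnn eqxx /= /b /vsub; ring.
  have -> : (i == j) = false by apply/eqP => e; rewrite e eqxx in ij.
  by rewrite /=; case: ifP => _; ring.
(* Subtracting the linear term first leaves a derivative that is a difference of partials, already
   known to be small. *)
have [c [Hc cb]] := @MVT_abs
  (fun t => f (vadd (hyb j) (vscal t (ebasis j))) - df j x * t)
  (fun t => df j (vadd (hyb j) (vscal t (ebasis j))) - df j x * 1) 0 b
  (fun c _ => derivable_pt_lim_minus _ _ _ _ _
     (shift_partial (fdf j _)) (derivable_pt_lim_scal _ _ _ _ (derivable_pt_lim_id _))).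
move: Hc; rewrite Rmult_0_r !Rminus_0_r Rmult_1_r.
have -> : vadd (hyb j) (vscal 0 (ebasis j)) = hyb j by vext; ring.
have -> : forall p q r : R, p - r - q = p - q - r by move=> *; ring.
move=> ->; apply: Rmult_le_compat_r; first exact: Rabs_pos.
apply/Rlt_le/Hd; apply: (Rle_lt_trans _ (nrm (vsub y x) + nrm (vsub z x))); last lra.
rewrite -rsumD; apply: rsum_le => i.
rewrite /vsub /vadd /vscal /hyb /ebasis; case: eqVneq => [->|_].
  rewrite ltnn Rmult_1_r; move: cb; rewrite /b /vsub.
  by rewrite /Rabs /Rmin /Rmax; repeat case: Rle_dec; repeat case: Rcase_abs; lra.
rewrite Rmult_0_r Rplus_0_r.
by case: ifP => _; have := Rabs_pos (y i - x i); have := Rabs_pos (z i - x i); lra.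
Qed.

Lemma pderivP n (f : vec n -> R) j x :
  (exists l, is_partial f j x l) -> is_partial f j x (pderiv f j x).
Proof. by move=> H; exact: epsilon_spec. Qed.

Lemma pderiv_unique n (f : vec n -> R) j x l : is_partial f j x l -> pderiv f j x = l.
Proof.
move=> H; apply: (uniqueness_limite _ _ _ _ _ H); apply: pderivP; by exists l.
Qed.

Lemma C2_sdiff n (f : vec n -> R) x : C2_scalar f -> sdiff f x (fun j => pderiv f j x).
Proof.
move=> [f1 [_ [c1 _]]]; apply: (@sdiff_of_partials _ _ (fun j => pderiv f j)).
  by move=> j y; apply: pderivP.
by move=> j; apply: vcontP.
Qed.

Lemma C2_sdiff2 n (f : vec n -> R) j x :
  C2_scalar f -> sdiff (pderiv f j) x (fun k => pderiv (pderiv f j) k x).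
Proof.
move=> [_ [f2 [_ c2]]]; apply: (@sdiff_of_partials _ _ (fun k => pderiv (pderiv f j) k)).
  by move=> k y; apply: pderivP.
by move=> k; apply: vcontP.
Qed.

(** Schwarz's theorem in two variables, applied on the plane [P] through [x] along the j-th and k-th
    basis vectors. Symmetry is what later moves the Hessian across the dot product in the polarity
    argument. *)
Lemma C2_sym n (f : vec n -> R) j k x :
  C2_scalar f -> pderiv (pderiv f j) k x = pderiv (pderiv f k) j x.
Proof.
move=> [f1 [f2 [c1 c2]]].
have DU F t l : derivable_pt_lim F t l -> Derive.Derive F t = l.
  by move=> H; apply/Derive.is_derive_unique/Derive.is_derive_Reals.
pose P a b := vadd (vadd x (vscal a (ebasis j))) (vscal b (ebasis k)).
have dk (F : vec n -> R) : (forall y, exists l, is_partial F k y l) ->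
    forall a b, derivable_pt_lim (fun b => F (P a b)) b (pderiv F k (P a b)).
  by move=> HF a b; apply/shift_partial/pderivP.
have PC a b : P a b = vadd (vadd x (vscal b (ebasis k))) (vscal a (ebasis j)).
  by rewrite /P; vext; ring.
have dj (F : vec n -> R) : (forall y, exists l, is_partial F j y l) ->
    forall a b, derivable_pt_lim (fun a => F (P a b)) a (pderiv F j (P a b)).
  move=> HF a b; rewrite PC.
  have -> : (fun a : R => F (P a b)) =
    fun a => F (vadd (vadd x (vscal b (ebasis k))) (vscal a (ebasis j))).
    by apply: functional_extensionality => ?; rewrite PC.
  by apply/shift_partial/pderivP.
(* The library theorem speaks of nested [Derive]; [D1] and [D2] identify these with the iterated
   [pderiv] on the plane. *)
have D1 : (fun u v => Derive.Derive (fun z => Derive.Derive (fun t => f (P z t)) v) u) =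
          fun u v => pderiv (pderiv f k) j (P u v).
  apply: functional_extensionality => u; apply: functional_extensionality => v.
  rewrite -(DU _ _ _ (dj _ (fun y => f2 k j y) u v)).
  apply: Derive.Derive_ext => z; exact: (DU _ _ _ (dk _ (f1 k) z v)).
have D2 : (fun u v => Derive.Derive (fun z => Derive.Derive (fun t => f (P t z)) u) v) =
          fun u v => pderiv (pderiv f j) k (P u v).
  apply: functional_extensionality => u; apply: functional_extensionality => v.
  rewrite -(DU _ _ _ (dk _ (fun y => f2 j k y) u v)).
  apply: Derive.Derive_ext => z; exact: (DU _ _ _ (dj _ (f1 j) u z)).
have P0 : P 0 0 = x by rewrite /P; vext; ring.
have ebn (i : 'I_n) : nrm (ebasis i) = 1.
  rewrite -[RHS](@rsum_delta n (fun=> 1) i); apply: eq_bigr => l _.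
  by rewrite /ebasis; case: eqP => _; rewrite ?Rabs_R1 ?Rabs_R0; ring.
have cont (F : vec n -> R) : vcontinuous F ->
    Continuity.continuity_2d_pt (fun u v => F (P u v)) 0 0.
  move=> cF eps; have [d [d0 Hd]] := cF x eps (cond_pos eps).
  have d2 : 0 < d / 2 by lra.
  exists (mkposreal _ d2) => u v /=; rewrite !Rminus_0_r P0 => ud vd.
  apply: Hd; apply: Rle_lt_trans (vnorm_le_nrm _) _.
  have -> : vsub (P u v) x = vadd (vscal u (ebasis j)) (vscal v (ebasis k)).
    by rewrite /P; vext; ring.
  by apply: Rle_lt_trans (nrmD _ _) _; rewrite !nrmZ !ebn; lra.
have := @Derive_2d.Schwarz (fun a b => f (P a b)) 0 0.
have -> := congr1 (fun F : R -> R -> R => F 0 0) D1.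
have -> := congr1 (fun F : R -> R -> R => F 0 0) D2.
rewrite D1 D2 P0 => H; apply/esym/H; try exact: cont.
exists (mkposreal _ Rlt_0_1) => u v _ _; split; [|split; [|split]].
- by eexists; apply/Derive.is_derive_Reals/dj.
- by eexists; apply/Derive.is_derive_Reals/dk.
- exists (pderiv (pderiv f k) j (P u v)).
  apply: Derive.is_derive_ext ((Derive.is_derive_Reals _ _ _).2 (dj _ (fun y => f2 k j y) u v)) => z.
  by rewrite (DU _ _ _ (dk _ (f1 k) z v)).
- exists (pderiv (pderiv f j) k (P u v)).
  apply: Derive.is_derive_ext ((Derive.is_derive_Reals _ _ _).2 (dk _ (fun y => f2 j k y) u v)) => z.
  by rewrite (DU _ _ _ (dj _ (f1 j) u z)).
Qed.

(** * Local surjectivity, tangents and normals along sequences *)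

Lemma nrm_eq0 n (u : vec n) : nrm u <= 0 -> u = @vzero n.
Proof.
move=> u0; apply: functional_extensionality => i; rewrite /vzero.
have ui0 : Rabs (u i) <= 0 by apply: Rle_trans u0; exact: coord_le_nrm.
by have := Rle_abs (u i); have := Rle_abs (- u i); rewrite Rabs_Ropp; lra.
Qed.

Lemma le_of_lim a b u : (forall k, a <= b + u k) -> Un_cv u 0 -> a <= b.
Proof.
move=> H u0; apply: Rle_plus_epsilon => eps e0.
have [N HN] := Un_cv_lt u0 e0; have := HN N (leqnn N); have := H N; lra.
Qed.

(* Banach's fixed point theorem for e |-> e + y - Phi e, started at 0. *)
Lemma perturbed_identity_solve d (Phi : vec d -> vec d) rho y :
  (forall e e', nrm e <= rho -> nrm e' <= rho ->
     nrm (vsub (vsub (Phi e) (Phi e')) (vsub e e')) <= / 2 * nrm (vsub e e')) ->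
  2 * nrm (vsub y (Phi (@vzero d))) <= rho ->
  exists e, nrm e <= 2 * nrm (vsub y (Phi (@vzero d))) /\ Phi e = y.
Proof.
move=> contr; set c := nrm _ => crho; have c0 : 0 <= c := nrm_ge0 _.
pose e k := iter k (fun e => vadd e (vsub y (Phi e))) (@vzero d).
have eS k : vsub (e k.+1) (e k) = vsub y (Phi (e k)) by rewrite /e /=; vext; ring.
(* Each step of the iteration is at most half the previous one. Summing these bounds keeps the
   iterates in the ball of radius 2c, where the contraction hypothesis is available. *)
pose q k := c / 2 ^ k.
have qS k : q k.+1 = q k / 2.
  by rewrite /q /=; field; apply: pow_nonzero; lra.
have q0 k : 0 <= q k.
  by apply: Rmult_le_pos => //; apply/Rlt_le/Rinv_0_lt_compat/pow_lt; lra.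
have inv k : nrm (e k) <= 2 * (c - q k) /\ nrm (vsub (e k.+1) (e k)) <= q k.
  elim: k => [|k [IH1 IH2]].
    by rewrite eS /e /= nrm0 -/c /q /=; lra.
  have ek1 : nrm (e k.+1) <= 2 * (c - q k.+1).
    have := nrm_le (e k.+1) (e k); rewrite qS; lra.
  split=> //; rewrite eS.
  (* Since e_{k+1} - e_k is the old residual, the new residual is the deviation of [Phi] from the
     identity over the last step. *)
  have -> : vsub y (Phi (e k.+1)) =
    vscal (-1) (vsub (vsub (Phi (e k.+1)) (Phi (e k))) (vsub (e k.+1) (e k))).
    by rewrite eS; vext; ring.
  rewrite nrmZ Rabs_Ropp Rabs_R1 Rmult_1_l qS.
  apply: Rle_trans (contr _ _ _ _) _; have := q0 k; have := q0 k.+1; lra.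
have far k p : nrm (vsub (e (p + k)%nat) (e k)) <= 2 * (q k - q (p + k)%nat).
  elim: p => [|p IH]; first by rewrite add0n nrm_subxx; lra.
  have := nrm_triangB (e (p.+1 + k)%nat) (e (p + k)%nat) (e k).
  have [_] := inv (p + k)%nat; rewrite addSn qS; lra.
have ql : Un_cv (fun k => 2 * q k) 0.
  have := CV_mult _ _ _ _ (Un_cv_cst 2) (cv_pow_half c); rewrite Rmult_0_r; exact.
have lim i : {l | Un_cv (fun k => e k i) l}.
  apply: Rcomplete.R_complete => eps e0; have e2 : 0 < eps / 2 by lra.
  have [N HN] := Un_cv_lt ql e2; exists N => k m /leP Nk /leP Nm.
  have dist p : leq N p -> Rabs (e p i - e N i) < eps / 2.
    move=> Np; have := coord_le_nrm (vsub (e p) (e N)) i; rewrite {1}/vsub.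
    have := far N (p - N)%nat; rewrite subnK //; have := HN N (leqnn N).
    have := q0 p; lra.
  have := dist k Nk; have := dist m Nm; rewrite /Rdist.
  have := Rabs_triang (e k i - e N i) (- (e m i - e N i)); rewrite Rabs_Ropp.
  have -> : e k i - e N i + - (e m i - e N i) = e k i - e m i by ring.
  lra.
pose l : vec d := fun i => sval (lim i).
have el : vlim e l by move=> i; exact: (svalP (lim i)).
have /vlim_nrm el0 := el.
have ek k : nrm (e k) <= 2 * c by have [] := inv k; have := q0 k; lra.
have lc : nrm l <= 2 * c.
  apply: le_of_lim el0 => k; have := nrm_le l (e k); rewrite nrmBC; have := ek k; lra.
exists l; split=> //.
suff /nrm_eq0 H : nrm (vsub y (Phi l)) <= 0.
  by apply: functional_extensionality => i; have := congr1 (fun u : vec d => u i) H;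
     rewrite /vsub /vzero; lra.
apply: (@le_of_lim _ _ (fun k => 2 * q k + 2 * nrm (vsub (e k) l))) => [k|].
  have := nrm_triangB y (Phi (e k)) (Phi l).
  have := contr (e k) l; have := nrm_le (vsub (Phi (e k)) (Phi l)) (vsub (e k) l).
  have [_] := inv k; rewrite eS; have := ek k; have := q0 k.
  have := nrm_ge0 (vsub (e k) l) => P1 P2 P3 P4 P5 P6 P7.
  have := P6 _ _; lra.
have := CV_plus _ _ _ _ ql (CV_mult _ _ _ _ (Un_cv_cst 2) el0).
by rewrite Rmult_0_r Rplus_0_r.
Qed.

(** Surjectivity in the form used for estimates: the lift [Q v] is linear in [v] and bounded through
    [mnrm Q]. *)
Definition right_invertible d n (F : mat d n) :=
  exists Q : mat n d, forall v, mulmv F (mulmv Q v) = v.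

Lemma right_invertible_surj d n (F : mat d n) :
  (forall y, exists v, mulmv F v = y) -> right_invertible F.
Proof.
move=> H; have c i := constructive_indefinite_description _ (H (@ebasis d i)).
exists (fun j i => sval (c i) j) => v; rewrite -mulmv_matmul.
apply: functional_extensionality => i; rewrite -[RHS](rsum_delta v).
apply: eq_bigr => j _; rewrite Rmult_comm; congr (_ * _).
transitivity (ebasis j i); last by rewrite /ebasis eq_sym.
exact: (congr1 (fun u : vec d => u i) (svalP (c j))).
Qed.

Lemma near_mnrm s n (F : vec n -> mat s n) x eps :
  (forall i j, vcont (fun y => F y i j) x) -> 0 < eps ->
  exists d, 0 < d /\ forall y, nrm (vsub y x) < d ->
    mnrm (fun i j => F y i j - F x i j) <= eps.
Proof.
move=> Fc e0; have s0 := pos_INR s; have n0 := pos_INR n.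
have sn0 : 0 <= INR s * INR n by nra.
have c0 : 0 < eps / (INR s * INR n + 1) by apply: Rdiv_lt_0_compat; lra.
set c := eps / _ in c0.
have [||d [d0 H]] := @finite_min s (fun i d => forall j y, nrm (vsub y x) < d ->
   Rabs (F y i j - F x i j) < c).
- by move=> i d d' d'd Pd j y ?; apply: Pd; lra.
- move=> i; apply: (@finite_min n (fun j d => forall y, nrm (vsub y x) < d ->
   Rabs (F y i j - F x i j) < c)) => [j d d' d'd Pd y ?|j]; first by apply: Pd; lra.
  exact: Fc.
exists d; split=> // y yx.
have -> : eps = INR s * (INR n * c) + c by rewrite /c; field; lra.
suff : mnrm (fun i j => F y i j - F x i j) <= INR s * (INR n * c) by lra.
rewrite -!rsum_cst; apply: rsum_le => i; apply: rsum_le => j.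
exact/Rlt_le/H.
Qed.

(* Lyusternik's theorem, along a sequence. *)
Lemma lift_sequence n d (f : vec n -> vec d) x (F : mat d n) t v u :
  (forall i, sdiff (fun y => f y i) x (F i)) -> right_invertible F ->
  (forall k, 0 < t k) -> Un_cv t 0 -> vlim v (mulmv F u) ->
  exists w, vlim w u /\
    ev (fun k => f (vadd x (vscal (t k) (w k))) = vadd (f x) (vscal (t k) (v k))).
Proof.
move=> fF [Q FQ] t0 tl vl; have Q0 := mnrm_ge0 Q; have u0 := nrm_ge0 u.
(* With this tolerance the linearization error on the increment [Q e] is at most half of [nrm e]. *)
have c0 : 0 < / (2 * (mnrm Q + 1)) by apply: Rinv_0_lt_compat; lra.
have [r [r0 Hr]] := sdiff_vec fF c0.
(* The lift is sought as w = u + Q e. After rescaling, the linear part of [Phi k] is F u + e, a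
   translated identity, and the equation becomes [Phi k e = v k]. *)
pose Phi k e := vscal (/ t k) (vsub (f (vadd x (vscal (t k) (vadd u (mulmv Q e))))) (f x)).
have Phi0 : vlim (fun k => Phi k (@vzero d)) (mulmv F u).
  move=> i; apply: (@Un_cv_eq (fun k => (f (vadd x (vscal (t k) u)) i - f x i) / t k)).
    move=> k; rewrite /Phi mulmv0.
    have -> : vadd u (@vzero n) = u by vext; ring.
    by rewrite /vscal /vsub; field; have := t0 k; lra.
  exact: sdiff_quotient (fF i) t0 tl (vlim_cst u).
have vPhi := (vlim_nrm _ _).1 (vlimB vl Phi0).
have tsmall : Un_cv (fun k => t k * (nrm u + mnrm Q)) 0.
  by rewrite -(Rmult_0_l (nrm u + mnrm Q)); apply: CV_mult tl (Un_cv_cst _).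
have e2 : 0 < / 2 by lra.
have : ev (fun k => exists e, nrm e <= 2 * nrm (vsub (v k) (Phi k (@vzero d))) /\
     Phi k e = v k).
  apply: ev_mono (ev_and (Un_cv_lt tsmall r0) (Un_cv_lt vPhi e2)) => k [tr vk].
  have tk := t0 k.
  have cl e : nrm e <= 1 -> nrm (vsub (vadd x (vscal (t k) (vadd u (mulmv Q e)))) x) < r.
    move=> e1; apply: Rle_lt_trans tr.
    have -> : vsub (vadd x (vscal (t k) (vadd u (mulmv Q e)))) x =
      vscal (t k) (vadd u (mulmv Q e)) by vext; ring.
    rewrite nrmZ Rabs_pos_eq; last exact: Rlt_le.
    apply: Rmult_le_compat_l; first exact: Rlt_le.
    have := nrmD u (mulmv Q e); have := nrm_mulmv_le Q e.
    have := Rmult_le_compat_l _ _ _ Q0 e1; lra.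
  (* On the unit ball all points stay within [r] of [x] because [t k] is small, and the residual at
     0 is below 1/2. *)
  apply: (@perturbed_identity_solve _ _ 1) => [e e' e1 e1'|].
    have {Hr} := Hr _ _ (cl _ e1) (cl _ e1').
    set y := vadd x _; set z := vadd x (vscal _ (vadd u (mulmv Q e'))).
    have yz : vsub y z = vscal (t k) (mulmv Q (vsub e e')).
      by rewrite mulmvB /y /z; vext; ring.
    have -> : vsub (vsub (Phi k e) (Phi k e')) (vsub e e') =
      vscal (/ t k) (vsub (vsub (f y) (f z)) (mulmv F (vsub y z))).
      by rewrite yz mulmvZ FQ /Phi -/y -/z; vext; field; lra.
    rewrite nrmZ yz nrmZ !Rabs_pos_eq; last exact: Rlt_le; last first.
      exact/Rlt_le/Rinv_0_lt_compat.
    move=> H; have := Rmult_le_compat_l _ _ _ (Rlt_le _ _ (Rinv_0_lt_compat _ tk)) H.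
    have := nrm_mulmv_le Q (vsub e e') => H1 H2; apply: Rle_trans H2 _.
    have -> : / t k * (/ (2 * (mnrm Q + 1)) * (t k * nrm (mulmv Q (vsub e e')))) =
      / (2 * (mnrm Q + 1)) * nrm (mulmv Q (vsub e e')) by field; lra.
    have -> : / 2 * nrm (vsub e e') =
      / (2 * (mnrm Q + 1)) * ((mnrm Q + 1) * nrm (vsub e e')) by field; lra.
    apply: Rmult_le_compat_l; first exact: Rlt_le.
    have := nrm_ge0 (vsub e e'); lra.
  have := nrm_le (vsub (v k) (Phi k (@vzero d))) (vsub (mulmv F u) (mulmv F u)).
  by rewrite nrm_subxx; lra.
move=> /ev_choice [e He]; exists (fun k => vadd u (mulmv Q (e k))); split; last first.
  apply: ev_mono He => k [_ <-]; rewrite /Phi; vext; field.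
  by have := t0 k; lra.
have el : vlim e (@vzero d).
  apply: (vlim_squeeze (v := fun k => 2 * nrm (vsub (v k) (Phi k (@vzero d))))).
    apply: ev_mono He => k [He _].
    by have -> : vsub (e k) (@vzero d) = e k by vext; ring.
  rewrite -(Rmult_0_r 2); apply: CV_mult (Un_cv_cst 2) _.
  apply: Un_cv_eq vPhi => k; congr nrm; by vext; ring.
have {2}-> : u = vadd u (mulmv Q (@vzero d)) by rewrite mulmv0; vext; ring.
exact: vlimD (vlim_cst _) (vlim_mulmv (mlim_cst _) el).
Qed.

(** * Cones described by eventual sequences *)

Lemma Un_cv_shift N u l : Un_cv u l -> Un_cv (fun k => u (k + N)%nat) l.
Proof.
move=> /Un_cvP ul; apply/Un_cvP => eps /ul [M HM]; exists M => k Mk.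
by apply: HM; exact: leq_trans Mk (leq_addr _ _).
Qed.

(** The finitely many indices that may fail are removed by a shift. *)
Lemma tangent_coneP n (A : vset n) a d : tangent_cone A a d <->
  exists t dk, (forall k, 0 < t k) /\ Un_cv t 0 /\ vlim dk d /\
    ev (fun k => A (vadd a (vscal (t k) (dk k)))).
Proof.
split=> [[t [dk [t0 [tl [/seq_cvgP dl H]]]]]|[t [dk [t0 [tl [dl [N H]]]]]]].
  by exists t, dk; do 3!split=> //; exact: ev_all.
exists (fun k => t (k + N)%nat), (fun k => dk (k + N)%nat).
split=> [k|]; first exact: t0.
split; first exact: Un_cv_shift.
split=> [|k]; last by apply: H; exact: leq_addl.
by apply/seq_cvgP => i; exact: Un_cv_shift (dl i).
Qed.

Lemma lim_normal_dirP n (A : vset n) a d v : lim_normal_dir A a d v <->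
  exists t dk vk, (forall k, 0 < t k) /\ Un_cv t 0 /\ vlim dk d /\ vlim vk v /\
    ev (fun k => reg_normal A (vadd a (vscal (t k) (dk k))) (vk k)).
Proof.
split=> [[t [dk [vk [t0 [tl [/seq_cvgP dl [/seq_cvgP vl H]]]]]]]|].
  by exists t, dk, vk; do 4!split=> //; exact: ev_all.
move=> [t [dk [vk [t0 [tl [dl [vl [N H]]]]]]]].
exists (fun k => t (k + N)%nat), (fun k => dk (k + N)%nat), (fun k => vk (k + N)%nat).
split=> [k|]; first exact: t0.
split; first exact: Un_cv_shift.
split; first by apply/seq_cvgP => i; exact: Un_cv_shift (dl i).
split=> [|k]; last by apply: H; exact: leq_addl.
by apply/seq_cvgP => i; exact: Un_cv_shift (vl i).
Qed.

(** Through a preimage, this makes every kernel direction tangent, which forces normals into the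
    range of the transpose. *)
Lemma tangent_cone0 n (A : vset n) a : A a -> tangent_cone A a (@vzero n).
Proof.
move=> Aa; apply/tangent_coneP; exists (fun k => 1 / 2 ^ k), (fun=> @vzero n).
split=> [k|]; first by apply: Rdiv_lt_0_compat; [lra|apply: pow_lt; lra].
split; first exact: cv_pow_half.
split; first exact: vlim_cst.
by apply: ev_all => k; have -> : vadd a (vscal (1 / 2 ^ k) (@vzero n)) = a by vext; ring.
Qed.

(** * Pairs and graphs *)

Lemma vfst_vcat n m (u : vec n) (v : vec m) : vfst (vcat u v) = u.
Proof.
by apply: functional_extensionality => i; rewrite /vfst /vcat (unsplitK (inl i)).
Qed.

Lemma vsnd_vcat n m (u : vec n) (v : vec m) : vsnd (vcat u v) = v.
Proof.
by apply: functional_extensionality => i; rewrite /vsnd /vcat (unsplitK (inr i)).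
Qed.

Lemma vcat_vfst_vsnd n m (p : vec (n + m)%nat) : vcat (vfst p) (vsnd p) = p.
Proof.
apply: functional_extensionality => i; rewrite /vcat -[in RHS](splitK i).
by case: (fintype.split i).
Qed.

Lemma vcat_step n m (a u : vec n) (b v : vec m) t :
  vadd (vcat a b) (vscal t (vcat u v)) = vcat (vadd a (vscal t u)) (vadd b (vscal t v)).
Proof. by vext; rewrite /vcat; case: (fintype.split i). Qed.

Lemma dot_vcat n m (a u : vec n) (b v : vec m) :
  dot (vcat a b) (vcat u v) = dot a u + dot b v.
Proof.
rewrite /dot big_split_ord; congr (_ + _); apply: eq_bigr => i _.
  by rewrite /vcat (unsplitK (inl i)).
by rewrite /vcat (unsplitK (inr i)).
Qed.

Lemma vcat0 n m : vcat (@vzero n) (@vzero m) = @vzero (n + m)%nat.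
Proof. by vext; rewrite /vcat; case: (fintype.split i). Qed.

Lemma vlim_vcat n m (x : nat -> vec n) (y : nat -> vec m) a b :
  vlim x a -> vlim y b -> vlim (fun k => vcat (x k) (y k)) (vcat a b).
Proof. by move=> xa yb i; rewrite /vcat; case: (fintype.split i). Qed.

Lemma vlim_vfst n m (x : nat -> vec (n + m)%nat) a b :
  vlim x (vcat a b) -> vlim (fun k => vfst (x k)) a.
Proof. by move=> xa; rewrite -(vfst_vcat a b) => i; exact: xa. Qed.

Lemma vlim_vsnd n m (x : nat -> vec (n + m)%nat) a b :
  vlim x (vcat a b) -> vlim (fun k => vsnd (x k)) b.
Proof. by move=> xa; rewrite -(vsnd_vcat a b) => i; exact: xa. Qed.

Lemma tangent_cone_gphP n m (G : vec n -> vset m) a b u v :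
  tangent_cone (gph G) (vcat a b) (vcat u v) <->
  exists t uk vk, (forall k, 0 < t k) /\ Un_cv t 0 /\ vlim uk u /\ vlim vk v /\
    ev (fun k => G (vadd a (vscal (t k) (uk k))) (vadd b (vscal (t k) (vk k)))).
Proof.
split=> [/tangent_coneP [t [dk [t0 [tl [dl H]]]]]|[t [uk [vk [t0 [tl [ul [vl H]]]]]]]].
  exists t, (fun k => vfst (dk k)), (fun k => vsnd (dk k)); do 2!split=> //.
  split; first exact: vlim_vfst dl.
  split; first exact: vlim_vsnd dl.
  by apply: ev_mono H => k; rewrite -{1}(vcat_vfst_vsnd (dk k)) vcat_step /gph vfst_vcat vsnd_vcat.
apply/tangent_coneP; exists t, (fun k => vcat (uk k) (vk k)); do 2!split=> //.
split; first exact: vlim_vcat.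
by apply: ev_mono H => k; rewrite vcat_step /gph vfst_vcat vsnd_vcat.
Qed.

Lemma lim_normal_dir_gphP n m (G : vec n -> vset m) a b u v p q :
  lim_normal_dir (gph G) (vcat a b) (vcat u v) (vcat p q) <->
  exists t uk vk pk qk, (forall k, 0 < t k) /\ Un_cv t 0 /\ vlim uk u /\ vlim vk v /\
    vlim pk p /\ vlim qk q /\
    ev (fun k => reg_normal (gph G)
      (vcat (vadd a (vscal (t k) (uk k))) (vadd b (vscal (t k) (vk k))))
      (vcat (pk k) (qk k))).
Proof.
split=> [/lim_normal_dirP [t [dk [ek [t0 [tl [dl [el H]]]]]]]|].
  exists t, (fun k => vfst (dk k)), (fun k => vsnd (dk k)).
  exists (fun k => vfst (ek k)), (fun k => vsnd (ek k)); do 2!split=> //.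
  split; first exact: vlim_vfst dl.
  split; first exact: vlim_vsnd dl.
  split; first exact: vlim_vfst el.
  split; first exact: vlim_vsnd el.
  by apply: ev_mono H => k; rewrite -vcat_step !vcat_vfst_vsnd.
move=> [t [uk [vk [pk [qk [t0 [tl [ul [vl [pl [ql H]]]]]]]]]]].
apply/lim_normal_dirP; exists t, (fun k => vcat (uk k) (vk k)), (fun k => vcat (pk k) (qk k)).
do 2!split=> //; split; first exact: vlim_vcat.
split; first exact: vlim_vcat.
by apply: ev_mono H => k; rewrite vcat_step.
Qed.

(** * Preimages under submersions *)

(* F is the Jacobian of f and S _ i the Hessian of its i-th component. *)
Record C2_with n d (f : vec n -> vec d) (F : vec n -> mat d n)
    (S : vec n -> 'I_d -> mat n n) : Prop := {
  C2_with_grad : forall x i, sdiff (fun y => f y i) x (F x i);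
  C2_with_grad2 : forall x i j, sdiff (fun y => F y i j) x (S x i j);
  C2_with_cont2 : forall x i j k, vcont (fun y => S y i j k) x;
  C2_with_sym : forall x i j k, S x i j k = S x i k j }.

(** For component Hessians [S], this is the Hessian of <mu, f>; see [hessian_dot]. *)
Definition wsum_mat n d (S : 'I_d -> mat n n) (mu : vec d) : mat n n :=
  fun j k => \big[Rplus/0]_(i < d) (mu i * S i j k).

Lemma dot_wsum_mat_sym n d (S : 'I_d -> mat n n) mu p q :
  (forall i j k, S i j k = S i k j) ->
  dot p (mulmv (wsum_mat S mu) q) = dot (mulmv (wsum_mat S mu) p) q.
Proof.
move=> Ssym; rewrite -dot_trmulmv; congr dot; vext; rewrite /trmulmv /mulmv /dot.
apply: eq_bigr => j _; congr (_ * _); apply: eq_bigr => k _; by rewrite Ssym.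
Qed.

Lemma C2_with_jacobian n d (f : vec n -> vec d) : C2 f ->
  C2_with f (jacobian f) (fun x i => hessian (fun y => f y i) x).
Proof.
move=> Cf; split=> [x i|x i j|x i j k|x i j k].
- exact (@C2_sdiff _ _ x (Cf i)).
- exact (@C2_sdiff2 _ _ j x (Cf i)).
- have [_ [_ [_ c2]]] := Cf i; exact (vcontP x (c2 j k)).
- exact (@C2_sym _ _ j k x (Cf i)).
Qed.

(** * Second-order calculus of composites *)

Lemma vcontM n (f g : vec n -> R) x : vcont f x -> vcont g x -> vcont (fun y => f y * g y) x.
Proof.
move=> fc gc eps e0.
(* The bound by 1 controls the product of the two increments by [c]. *)
pose c := Rmin 1 (eps / (Rabs (f x) + Rabs (g x) + 2)).
have [a0 b0] : 0 <= Rabs (f x) /\ 0 <= Rabs (g x) by split; exact: Rabs_pos.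
have c0 : 0 < c by apply: Rmin_pos; [lra|apply: Rdiv_lt_0_compat; lra].
have [c1 c2] : c <= 1 /\ c <= eps / (Rabs (f x) + Rabs (g x) + 2).
  by split; [exact: Rmin_l|exact: Rmin_r].
have [[d [d0 Hd]] [e [e0' He]]] := (fc c c0, gc c c0).
exists (Rmin d e); split=> [|y /Rmin_Rgt [/Hd fy /He gy]]; first exact: Rmin_pos.
have -> : f y * g y - f x * g x = (f y - f x) * (g y - g x) + f x * (g y - g x) +
  (f y - f x) * g x by ring.
have T1 := Rabs_triang ((f y - f x) * (g y - g x) + f x * (g y - g x)) ((f y - f x) * g x).
have T2 := Rabs_triang ((f y - f x) * (g y - g x)) (f x * (g y - g x)).
move: T1 T2; rewrite !Rabs_mult.
have P1 := Rabs_pos (f y - f x); have P2 := Rabs_pos (g y - g x).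
have : eps = eps / (Rabs (f x) + Rabs (g x) + 2) * (Rabs (f x) + Rabs (g x) + 2) by field; lra.
have : c * (Rabs (f x) + Rabs (g x) + 2) <=
  eps / (Rabs (f x) + Rabs (g x) + 2) * (Rabs (f x) + Rabs (g x) + 2).
  by apply: Rmult_le_compat_r => //; lra.
have : Rabs (f y - f x) * Rabs (g y - g x) <= c * 1 by apply: Rmult_le_compat; lra.
have : Rabs (f x) * Rabs (g y - g x) <= Rabs (f x) * c by apply: Rmult_le_compat_l; lra.
have : Rabs (f y - f x) * Rabs (g x) <= c * Rabs (g x) by apply: Rmult_le_compat_r; lra.
lra.
Qed.

Lemma vcont_rsum n m (f : 'I_m -> vec n -> R) x : (forall i, vcont (f i) x) ->
  vcont (fun y => \big[Rplus/0]_(i < m) f i y) x.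
Proof.
move=> fc eps e0; have m0 := pos_INR m.
have c0 : 0 < eps / (INR m + 1) by apply: Rdiv_lt_0_compat; lra.
have [|d [d0 Hd]] := @finite_min m (fun j d =>
    forall y, nrm (vsub y x) < d -> Rabs (f j y - f j x) < eps / (INR m + 1)) _
    (fun j => fc j _ c0).
  by move=> i d d' d'd Pd y ?; apply: Pd; lra.
exists d; split=> // y yx.
have -> : \big[Rplus/0]_(i < m) f i y - \big[Rplus/0]_(i < m) f i x =
  \big[Rplus/0]_(i < m) (f i y - f i x).
  rewrite /Rminus -(Rmult_1_l (\big[_/_]_(i < m) f i x)) Ropp_mult_distr_l -rsumZ -rsumD.
  by apply: eq_bigr => i _; ring.
apply: Rle_lt_trans (Rabs_rsum _) _.
apply: (Rle_lt_trans _ (INR m * (eps / (INR m + 1)))).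
  by rewrite -rsum_cst; apply: rsum_le => i; apply/Rlt_le/Hd.
have {2}-> : eps = (INR m + 1) * (eps / (INR m + 1)) by field; lra.
by apply: Rmult_lt_compat_r; lra.
Qed.

Lemma vcont_comp n s (h : vec s -> R) (g : vec n -> vec s) x :
  vcont h (g x) -> (forall i, vcont (fun y => g y i) x) -> vcont (fun y => h (g y)) x.
Proof.
move=> hc gc eps /hc [r [r0 Hr]]; have s0 := pos_INR s.
have c0 : 0 < r / (INR s + 1) by apply: Rdiv_lt_0_compat; lra.
have [|d [d0 Hd]] := @finite_min s (fun j d =>
    forall y, nrm (vsub y x) < d -> Rabs (g y j - g x j) < r / (INR s + 1)) _
    (fun j => gc j _ c0).
  by move=> i d d' d'd Pd y ?; apply: Pd; lra.
exists d; split=> // y yx; apply: Hr.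
apply: (Rle_lt_trans _ (INR s * (r / (INR s + 1)))).
  by rewrite -rsum_cst; apply: rsum_le => i; apply/Rlt_le/Hd.
have {2}-> : r = (INR s + 1) * (r / (INR s + 1)) by field; lra.
by apply: Rmult_lt_compat_r; lra.
Qed.

Lemma vcontD n (f g : vec n -> R) x : vcont f x -> vcont g x -> vcont (fun y => f y + g y) x.
Proof.
move=> fc gc eps e0; have e2 : 0 < eps / 2 by lra.
have [[d [d0 Hd]] [e [e0' He]]] := (fc _ e2, gc _ e2).
exists (Rmin d e); split=> [|y /Rmin_Rgt [/Hd fy /He gy]]; first exact: Rmin_pos.
have -> : f y + g y - (f x + g x) = (f y - f x) + (g y - g x) by ring.
by apply: Rle_lt_trans (Rabs_triang _ _) _; lra.
Qed.

(** The Hessian of the i-th component of h o g, namely G^T SH_i G plus the sum of H_il SG_l, in the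
    shape that [sdiffM] and [sdiff_comp] produce. *)
Definition comp_hess n s d (H : mat d s) (SH : 'I_d -> mat s s) (G : mat s n)
    (SG : 'I_s -> mat n n) : 'I_d -> mat n n := fun i j k =>
  \big[Rplus/0]_(l < s) (G l j * (\big[Rplus/0]_(m < s) (G m k * SH i l m)) +
                         H i l * SG l j k).

(** Closure under composition is the reason for carrying explicit derivatives: the composite is
    handled without computing its [pderiv]. *)
Lemma C2_with_comp n s d (h : vec s -> vec d) H SH (g : vec n -> vec s) G SG :
  C2_with h H SH -> C2_with g G SG ->
  C2_with (fun x => h (g x)) (fun x => matmul (H (g x)) (G x))
          (fun x => comp_hess (H (g x)) (SH (g x)) (G x) (SG x)).
Proof.
move=> Ch Cg.
have gc x i : vcont (fun y => g y i) x by exact: sdiff_cont (C2_with_grad Cg x i).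
have Hc x i j : vcont (fun y => H (g y) i j) x.
  exact: (vcont_comp (h := fun y => H y i j) (sdiff_cont (C2_with_grad2 Ch _ i j)) (gc x)).
have Gc x i j : vcont (fun y => G y i j) x by exact: sdiff_cont (C2_with_grad2 Cg x i j).
split=> [x i|x i j|x i j k|x i j k].
- have := sdiff_comp (C2_with_grad Ch (g x) i) (C2_with_grad Cg x).
  congr sdiff; apply: functional_extensionality => j; apply: eq_bigr => l _.
  by rewrite Rmult_comm.
- have := @sdiff_rsum _ _ (fun l y => H (g y) i l * G y l j) x _ (fun l =>
    sdiffM (sdiff_comp (C2_with_grad2 Ch (g x) i l) (C2_with_grad Cg x))
           (C2_with_grad2 Cg x l j)).
  congr sdiff; apply: functional_extensionality => k; apply: eq_bigr => l _.
- apply: (@vcont_rsum _ _ (fun l y => G y l j * (\big[Rplus/0]_(m < s) (G y m k * SH (g y) i l m)) +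
      H (g y) i l * SG y l j k)) => l.
  apply: vcontD; apply: vcontM.
  + exact: Gc.
  + apply: vcont_rsum => m; apply: vcontM; first exact: Gc.
    by apply: (@vcont_comp _ _ (fun y => SH y i l m)) (gc x); exact: (C2_with_cont2 Ch).
  + exact: Hc.
  + exact: (C2_with_cont2 Cg).
- rewrite /comp_hess !rsumD; congr (_ + _); last first.
    by apply: eq_bigr => l _; rewrite (C2_with_sym Cg).
  transitivity (\big[Rplus/0]_(l < s) \big[Rplus/0]_(m < s)
      (G x l j * (G x m k * SH (g x) i l m))).
    by apply: eq_bigr => l _; rewrite rsumZ.
  rewrite exchange_big; apply: eq_bigr => l _; rewrite -rsumZ; apply: eq_bigr => m _.
  by rewrite (C2_with_sym Ch); ring.
Qed.

Lemma mulmv_wsum_comp n s d (H : mat d s) SH (G : mat s n) SG mu u :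
  mulmv (wsum_mat (comp_hess H SH G SG) mu) u =
  vadd (trmulmv G (mulmv (wsum_mat SH mu) (mulmv G u)))
       (mulmv (wsum_mat SG (trmulmv H mu)) u).
Proof.
pose M1 : mat n n := fun j k => \big[Rplus/0]_(l < s)
  (G l j * \big[Rplus/0]_(m < s) (wsum_mat SH mu l m * G m k)).
have -> : trmulmv G (mulmv (wsum_mat SH mu) (mulmv G u)) = mulmv M1 u.
  rewrite -mulmv_matmul; vext; rewrite /M1 /mulmv /trmulmv /dot.
  transitivity (\big[Rplus/0]_(l < s) \big[Rplus/0]_(k < n)
     (G l i * (matmul (wsum_mat SH mu) G l k * u k))).
    by apply: eq_bigr => l _; rewrite rsumZ.
  rewrite exchange_big; apply: eq_bigr => k _; rewrite -rsumZr; apply: eq_bigr => l _.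
  by rewrite /matmul; ring.
vext; rewrite /mulmv /dot -rsumD; apply: eq_bigr => k _.
rewrite -Rmult_plus_distr_r; congr (_ * _); rewrite /M1 /wsum_mat /comp_hess /trmulmv.
rewrite -rsumD.
transitivity (\big[Rplus/0]_(i0 < d) \big[Rplus/0]_(l < s)
   (mu i0 * (G l i * (\big[Rplus/0]_(m < s) (G m k * SH i0 l m)) + H i0 l * SG l i k))).
  by apply: eq_bigr => i0 _; rewrite rsumZ.
rewrite exchange_big; apply: eq_bigr => l _.
transitivity (\big[Rplus/0]_(i0 < d) (G l i * (mu i0 * (\big[Rplus/0]_(m < s) (G m k * SH i0 l m))))
  + \big[Rplus/0]_(i0 < d) ((H i0 l * mu i0) * SG l i k)).
  by rewrite -rsumD; apply: eq_bigr => i0 _; ring.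
rewrite rsumZr rsumZ; congr (_ * _ + _).
transitivity (\big[Rplus/0]_(i0 < d) \big[Rplus/0]_(m < s) (mu i0 * SH i0 l m * G m k)).
  by apply: eq_bigr => i0 _; rewrite -rsumZ; apply: eq_bigr => m _; ring.
by rewrite exchange_big; apply: eq_bigr => m _; rewrite rsumZr.
Qed.

Lemma C2_with_cvg n d (f : vec n -> vec d) F S x X : C2_with f F S ->
  vlim X x -> mlim (fun k => F (X k)) (F x).
Proof.
move=> C Xx i j.
exact: (vcont_lim (f := fun y => F y i j) (sdiff_cont (C2_with_grad2 C x i j)) Xx).
Qed.

Lemma C2_with_cvg_hess n d (f : vec n -> vec d) F S x X mu M : C2_with f F S ->
  vlim X x -> vlim M mu ->
  mlim (fun k => wsum_mat (S (X k)) (M k)) (wsum_mat (S x) mu).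
Proof.
move=> C Xx Mmu j k.
apply: (@Un_cv_rsum _ (fun l i => M l i * S (X l) i j k)) => i.
apply: CV_mult; first exact: Mmu.
exact: (vcont_lim (f := fun y => S y i j k) (C2_with_cont2 C x i j k) Xx).
Qed.

(** The origin of the term B u in the tangents: it is the derivative of y |-> F(y)^T mu at [x]. *)
Lemma C2_with_quotient n d (f : vec n -> vec d) F S x t uk u mu : C2_with f F S ->
  (forall k, 0 < t k) -> Un_cv t 0 -> vlim uk u ->
  vlim (fun k => vscal (/ t k)
    (vsub (trmulmv (F (vadd x (vscal (t k) (uk k)))) mu) (trmulmv (F x) mu)))
    (mulmv (wsum_mat (S x) mu) u).
Proof.
move=> C t0 tl ul j.
have -> : mulmv (wsum_mat (S x) mu) u j = \big[Rplus/0]_(i < d) (mu i * dot (S x i j) u).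
  rewrite /mulmv /wsum_mat /dot.
  transitivity (\big[Rplus/0]_(k < n) \big[Rplus/0]_(i < d) (mu i * S x i j k * u k)).
    by apply: eq_bigr => k _; rewrite rsumZr.
  rewrite exchange_big; apply: eq_bigr => i _; rewrite -rsumZ.
  by apply: eq_bigr => k _; ring.
apply: (@Un_cv_eq (fun k => \big[Rplus/0]_(i < d)
    (mu i * ((F (vadd x (vscal (t k) (uk k))) i j - F x i j) / t k)))) => [k|].
  rewrite /vscal vsubE /vadd /vscal /trmulmv -rsumZ -rsumD -rsumZ; apply: eq_bigr => i _.
  by field; have := t0 k; lra.
apply: (@Un_cv_rsum _ (fun k i =>
    mu i * ((F (vadd x (vscal (t k) (uk k))) i j - F x i j) / t k))) => i.
exact: CV_mult (Un_cv_cst _) (sdiff_quotient (C2_with_grad2 C x i j) t0 tl ul).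
Qed.

(** The description of [A] is local because (A1) describes D only near g(xb). It persists at nearby
    points ([submersion_open]), where the regular normals of a limiting sequence live. *)
Record submersion_at n d (f : vec n -> vec d) F S (A : vset n) (Th : vset d) x : Prop := {
  sub_C2 : C2_with f F S;
  sub_inv : right_invertible (F x);
  sub_loc : exists r, 0 < r /\ forall y, nrm (vsub y x) < r -> (A y <-> Th (f y)) }.

(* The bound on e is what makes the solutions of perturbed equations converge. *)
Lemma near_solvable n d (f : vec n -> vec d) F S x (Q : mat n d) :
  C2_with f F S -> (forall v, mulmv (F x) (mulmv Q v) = v) ->
  exists r, 0 < r /\ forall y, nrm (vsub y x) < r ->
    forall v, exists e, nrm e <= 2 * nrm v /\ mulmv (F y) (mulmv Q e) = v.
Proof.
move=> C FQ; have Q0 := mnrm_ge0 Q.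
have c0 : 0 < / (2 * (mnrm Q + 1)) by apply: Rinv_0_lt_compat; lra.
have [|r [r0 Hr]] := @near_mnrm _ _ F x _ _ c0.
  by move=> i j; exact: sdiff_cont (C2_with_grad2 C x i j).
exists r; split=> // y /Hr Fy v.
have Z : vsub v (mulmv (F y) (mulmv Q (@vzero d))) = v by rewrite !mulmv0; vext; ring.
have := @perturbed_identity_solve _ (fun e => mulmv (F y) (mulmv Q e)) (2 * nrm v) v.
rewrite Z; apply; last lra; move=> e e' _ _; rewrite -!mulmvB.
set w := vsub e e'.
(* As F(x) Q is the identity, the deviation of F(y) Q from it is (F(y) - F(x)) Q, small by
   continuity of [F]. *)
have -> : vsub (mulmv (F y) (mulmv Q w)) w =
    mulmv (fun i j => F y i j - F x i j) (mulmv Q w).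
  rewrite -[X in vsub _ X]FQ vsubE; vext; rewrite /mulmv /dot -rsumZ -rsumD.
  by apply: eq_bigr => j _; ring.
apply: Rle_trans (nrm_mulmv_le _ _) _.
have H1 := nrm_mulmv_le Q w; have w0 := nrm_ge0 w.
have D0 := mnrm_ge0 (fun i j => F y i j - F x i j).
apply: (Rle_trans _ (/ (2 * (mnrm Q + 1)) * ((mnrm Q + 1) * nrm w))).
  apply: Rmult_le_compat => //; first exact: nrm_ge0.
  lra.
by right; field; lra.
Qed.

Lemma submersion_open n d (f : vec n -> vec d) F S A Th x :
  submersion_at f F S A Th x ->
  exists r, 0 < r /\ forall y, nrm (vsub y x) < r -> submersion_at f F S A Th y.
Proof.
move=> [C [Q FQ] [r [r0 Hr]]]; have [e [e0 He]] := near_solvable C FQ.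
exists (Rmin e (r / 2)); split=> [|y /Rmin_Rgt [ye yr]]; first by apply: Rmin_pos; lra.
split=> //.
  apply: right_invertible_surj => v; have [w [_ Fw]] := He y ye v.
  by exists (mulmv Q w).
exists (r / 2); split=> [|z zy]; first lra.
by apply: Hr; have := nrm_triangB z y x; lra.
Qed.

Lemma submersion_ev n d (f : vec n -> vec d) F S A Th x X :
  submersion_at f F S A Th x -> vlim X x ->
  ev (fun k => submersion_at f F S A Th (X k)).
Proof.
move=> /submersion_open [r [r0 Hr]] /vlim_nrm Xx.
by apply: ev_mono (Un_cv_lt Xx r0) => k; exact: Hr.
Qed.

Lemma submersion_loc_ev n d (f : vec n -> vec d) F S A Th x X :
  submersion_at f F S A Th x -> vlim X x ->
  ev (fun k => A (X k) <-> Th (f (X k))).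
Proof.
move=> L /(submersion_ev L); apply: ev_mono => k [_ _ [r [r0 H]]].
by apply: H; rewrite nrm_subxx.
Qed.

Lemma submersion_mem n d (f : vec n -> vec d) F S A Th x :
  submersion_at f F S A Th x -> (A x <-> Th (f x)).
Proof. by move=> [_ _ [r [r0 H]]]; apply: H; rewrite nrm_subxx. Qed.

Lemma image_direction n d (f : vec n -> vec d) F S x t uk u : C2_with f F S ->
  (forall k, 0 < t k) -> Un_cv t 0 -> vlim uk u ->
  exists vk, vlim vk (mulmv (F x) u) /\
    forall k, f (vadd x (vscal (t k) (uk k))) = vadd (f x) (vscal (t k) (vk k)).
Proof.
move=> C t0 tl ul.
exists (fun k i => (f (vadd x (vscal (t k) (uk k))) i - f x i) / t k); split.
  by move=> i; exact: sdiff_quotient (C2_with_grad C x i) t0 tl ul.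
by move=> k; vext; field; have := t0 k; lra.
Qed.

(** Forward, difference quotients carry the sequence; backward, [lift_sequence] hits the given
    points of [Th] exactly, so membership transfers. *)
Lemma tangent_preimage n d (f : vec n -> vec d) F S A Th x u :
  submersion_at f F S A Th x ->
  tangent_cone A x u <-> tangent_cone Th (f x) (mulmv (F x) u).
Proof.
move=> L; have [C inv _] := L; split=> /tangent_coneP [t [uk [t0 [tl [ul H]]]]].
  have [vk [vl fv]] := image_direction x C t0 tl ul.
  apply/tangent_coneP; exists t, vk; do 3!split=> //.
  apply: ev_mono (ev_and H (submersion_loc_ev L (vlim_small x tl ul))) => k [Ak Hk].
  by rewrite -fv; apply/Hk.
have [w [wl fw]] := lift_sequence (C2_with_grad C x) inv t0 tl ul.
apply/tangent_coneP; exists t, w; do 3!split=> //.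
apply: ev_mono (ev_and (ev_and H fw) (submersion_loc_ev L (vlim_small x tl wl))).
by move=> k [[Tk fk] Hk]; apply/Hk; rewrite fk.
Qed.

(** Kernel directions are tangent with both signs, so a normal is orthogonal to the kernel and has
    the form F^T mu. Surjectivity then makes every tangent of [Th] an image F u. *)
Lemma reg_normal_preimage n d (f : vec n -> vec d) F S A Th x v :
  submersion_at f F S A Th x ->
  reg_normal A x v <-> exists mu, v = trmulmv (F x) mu /\ reg_normal Th (f x) mu.
Proof.
move=> L; have [C [Q FQ] _] := L; split=> [[Ax Hv]|[mu [-> [Tx Hmu]]]].
  have Tx := (submersion_mem L).1 Ax.
  have Hker u : mulmv (F x) u = @vzero d -> dot v u = 0.
    move=> Fu0; have T u' : mulmv (F x) u' = @vzero d -> dot v u' <= 0.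
      by move=> E; apply/Hv/(tangent_preimage _ L); rewrite E; exact: tangent_cone0.
    have := T u Fu0; have := T (vscal (-1) u); rewrite mulmvZ Fu0 dotZr => H.
    by have : - 1 * dot v u <= 0 by [apply: H; vext; ring]; lra.
  have vE := tr_kernel_range FQ Hker.
  exists (trmulmv Q v); split=> //; split=> // w Tw.
  rewrite dot_trmulmv; apply/Hv/(tangent_preimage _ L).
  by rewrite FQ.
split=> [|u /(tangent_preimage _ L) Tu]; first exact/(submersion_mem L).
by rewrite dot_trmulmv; exact: Hmu.
Qed.

Lemma vlim_unique n (x : nat -> vec n) a b : vlim x a -> vlim x b -> a = b.
Proof. by move=> xa xb; apply: functional_extensionality => i; exact: UL_sequence (xa i) (xb i). Qed.

(** Rewrites a sequence in gph N_A in the coordinates (f, multiplier). The substance is the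
    convergence of [mk]: F(x_k)^T m_k equals us_k minus the difference quotient of F^T mu, which
    converges, so [trmulmv_lim_inv] applies. *)
Lemma normal_gph_push n d (f : vec n -> vec d) F S A Th x mu t uk usk u us :
  submersion_at f F S A Th x ->
  (forall k, 0 < t k) -> Un_cv t 0 -> vlim uk u -> vlim usk us ->
  ev (fun k => reg_normal A (vadd x (vscal (t k) (uk k)))
                 (vadd (trmulmv (F x) mu) (vscal (t k) (usk k)))) ->
  exists vk mk m, vlim vk (mulmv (F x) u) /\ vlim mk m /\
    us = vadd (trmulmv (F x) m) (mulmv (wsum_mat (S x) mu) u) /\
    (forall k, f (vadd x (vscal (t k) (uk k))) = vadd (f x) (vscal (t k) (vk k))) /\
    ev (fun k => vadd (trmulmv (F x) mu) (vscal (t k) (usk k)) =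
           trmulmv (F (vadd x (vscal (t k) (uk k)))) (vadd mu (vscal (t k) (mk k))) /\
         reg_normal Th (vadd (f x) (vscal (t k) (vk k))) (vadd mu (vscal (t k) (mk k)))).
Proof.
move=> L t0 tl ul usl H; have [C [Q FQ] _] := L.
have Xx := vlim_small x tl ul.
have [vk [vl fv]] := image_direction x C t0 tl ul.
have : ev (fun k => exists m,
    vadd (trmulmv (F x) mu) (vscal (t k) (usk k)) =
      trmulmv (F (vadd x (vscal (t k) (uk k)))) (vadd mu (vscal (t k) m)) /\
    reg_normal Th (vadd (f x) (vscal (t k) (vk k))) (vadd mu (vscal (t k) m))).
  apply: ev_mono (ev_and H (submersion_ev L Xx)) => k [Hk Lk].
  have [nu [E Hnu]] := (reg_normal_preimage _ Lk).1 Hk.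
  (* The new multiplier is written as [mu] plus [t k] times its difference quotient, the form of a
     tangent sequence. *)
  have nuE : nu = vadd mu (vscal (t k) (vscal (/ t k) (vsub nu mu))).
    by vext; field; have := t0 k; lra.
  by exists (vscal (/ t k) (vsub nu mu)); rewrite -nuE E -fv.
move=> /ev_choice [mk Hmk].
have Fm : vlim (fun k => trmulmv (F (vadd x (vscal (t k) (uk k)))) (mk k))
               (vsub us (mulmv (wsum_mat (S x) mu) u)).
  apply: vlim_ext_ev (vlimB usl (C2_with_quotient x mu C t0 tl ul)).
  apply: ev_mono Hmk => k [E _].
  have -> : usk k = vscal (/ t k) (vsub (vadd (trmulmv (F x) mu) (vscal (t k) (usk k)))
                                        (trmulmv (F x) mu)).
    by vext; field; have := t0 k; lra.
  rewrite E trmulmvD trmulmvZ; vext; field; have := t0 k; lra.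
have FF := C2_with_cvg C Xx.
have ml := trmulmv_lim_inv FQ FF Fm.
exists vk, mk, (trmulmv Q (vsub us (mulmv (wsum_mat (S x) mu) u))).
do 2!split=> //; split; last by split.
rewrite -(vlim_unique Fm (vlim_trmulmv FF ml)); vext; ring.
Qed.

(** The pointwise identities are returned with the membership, so that normals to the graphs can be
    transported at the very same points. *)
Lemma normal_gph_pull n d (f : vec n -> vec d) F S A Th x mu t vk mk u m :
  submersion_at f F S A Th x ->
  (forall k, 0 < t k) -> Un_cv t 0 -> vlim vk (mulmv (F x) u) -> vlim mk m ->
  ev (fun k => reg_normal Th (vadd (f x) (vscal (t k) (vk k))) (vadd mu (vscal (t k) (mk k)))) ->
  exists uk usk, vlim uk u /\
    vlim usk (vadd (trmulmv (F x) m) (mulmv (wsum_mat (S x) mu) u)) /\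
    ev (fun k => f (vadd x (vscal (t k) (uk k))) = vadd (f x) (vscal (t k) (vk k)) /\
         vadd (trmulmv (F x) mu) (vscal (t k) (usk k)) =
           trmulmv (F (vadd x (vscal (t k) (uk k)))) (vadd mu (vscal (t k) (mk k))) /\
         reg_normal A (vadd x (vscal (t k) (uk k)))
                 (vadd (trmulmv (F x) mu) (vscal (t k) (usk k)))).
Proof.
move=> L t0 tl vl ml H; have [C inv _] := L.
have [uk [ul fu]] := lift_sequence (C2_with_grad C x) inv t0 tl vl.
have Xx := vlim_small x tl ul.
(* This choice of [usk] is forced by F(x)^T mu + t_k us_k = F(x_k)^T (mu + t_k m_k). *)
exists uk, (fun k => vadd (trmulmv (F (vadd x (vscal (t k) (uk k)))) (mk k)) (vscal (/ t k)
    (vsub (trmulmv (F (vadd x (vscal (t k) (uk k)))) mu) (trmulmv (F x) mu)))).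
split=> //; split.
  apply: vlimD; first exact: vlim_trmulmv (C2_with_cvg C Xx) ml.
  exact (C2_with_quotient x mu C t0 tl ul).
apply: ev_mono (ev_and (ev_and H fu) (submersion_ev L Xx)) => k [[Hk fk] Lk].
have E : vadd (trmulmv (F x) mu) (vscal (t k)
   (vadd (trmulmv (F (vadd x (vscal (t k) (uk k)))) (mk k)) (vscal (/ t k)
    (vsub (trmulmv (F (vadd x (vscal (t k) (uk k)))) mu) (trmulmv (F x) mu))))) =
   trmulmv (F (vadd x (vscal (t k) (uk k)))) (vadd mu (vscal (t k) (mk k))).
  rewrite trmulmvD trmulmvZ; vext; field; have := t0 k; lra.
do 2!split=> //; rewrite E; apply/(reg_normal_preimage _ Lk).
by exists (vadd mu (vscal (t k) (mk k))); rewrite fk.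
Qed.

Lemma tangent_gph_normal n d (f : vec n -> vec d) F S A Th x mu u us :
  submersion_at f F S A Th x ->
  tangent_cone (gph (reg_normal A)) (vcat x (trmulmv (F x) mu)) (vcat u us) <->
  exists m, us = vadd (trmulmv (F x) m) (mulmv (wsum_mat (S x) mu) u) /\
    tangent_cone (gph (reg_normal Th)) (vcat (f x) mu) (vcat (mulmv (F x) u) m).
Proof.
move=> L; split.
  move=> /tangent_cone_gphP [t [uk [usk [t0 [tl [ul [usl H]]]]]]].
  have [vk [mk [m [vl [ml [E [_ Hk]]]]]]] := normal_gph_push L t0 tl ul usl H.
  exists m; split=> //; apply/tangent_cone_gphP; exists t, vk, mk; do 4!split=> //.
  by apply: ev_mono Hk => k [].
move=> [m [-> /tangent_cone_gphP [t [vk [mk [t0 [tl [vl [ml H]]]]]]]]].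
have [uk [usk [ul [usl Hk]]]] := normal_gph_pull L t0 tl vl ml H.
apply/tangent_cone_gphP; exists t, uk, usk; do 4!split=> //.
by apply: ev_mono Hk => k [_ []].
Qed.

(** The pairing identity [key] turns <p, u> + <q, F^T m + B u> into <p + B q, u> + <F q, m>, by
    symmetry of B. Tangents with m = 0 and u in the kernel force p + B q into the range of F^T. *)
Lemma reg_normal_gph_normal n d (f : vec n -> vec d) F S A Th x mu p q :
  submersion_at f F S A Th x ->
  reg_normal (gph (reg_normal A)) (vcat x (trmulmv (F x) mu)) (vcat p q) <->
  exists a, vadd p (mulmv (wsum_mat (S x) mu) q) = trmulmv (F x) a /\
    reg_normal (gph (reg_normal Th)) (vcat (f x) mu) (vcat a (mulmv (F x) q)).
Proof.
move=> L; have [C [Q FQ] _] := L.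
have Bsym := dot_wsum_mat_sym mu q _ (C2_with_sym C x).
have key m u : dot p u + dot q (vadd (trmulmv (F x) m) (mulmv (wsum_mat (S x) mu) u)) =
    dot (vadd p (mulmv (wsum_mat (S x) mu) q)) u + dot (mulmv (F x) q) m.
  by rewrite dotDr dotDl Bsym (dotC q) dot_trmulmv (dotC m); ring.
split=> [[Gx Hp]|[a [E [Gx Ha]]]].
  have [mu' [E Hmu]] : exists mu', trmulmv (F x) mu = trmulmv (F x) mu' /\
      reg_normal Th (f x) mu'.
    by apply/(reg_normal_preimage _ L); move: Gx; rewrite /gph vfst_vcat vsnd_vcat.
  (* F^T is injective, so the multiplier found is [mu] itself. *)
  have {mu' E} Hmu : reg_normal Th (f x) mu.
    by rewrite -(tr_right_inv FQ mu) E (tr_right_inv FQ).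
  have Gmu : gph (reg_normal Th) (vcat (f x) mu) by rewrite /gph vfst_vcat vsnd_vcat.
  have H m u : tangent_cone (gph (reg_normal Th)) (vcat (f x) mu) (vcat (mulmv (F x) u) m) ->
      dot (vadd p (mulmv (wsum_mat (S x) mu) q)) u + dot (mulmv (F x) q) m <= 0.
    move=> T; rewrite -key -dot_vcat; apply: Hp; apply/(tangent_gph_normal _ _ _ L).
    by exists m.
  have Hker u : mulmv (F x) u = @vzero d ->
      dot (vadd p (mulmv (wsum_mat (S x) mu) q)) u = 0.
    have T u' : mulmv (F x) u' = @vzero d ->
        dot (vadd p (mulmv (wsum_mat (S x) mu) q)) u' <= 0.
      move=> E; have := H (@vzero d) u'; rewrite E vcat0 dot0r Rplus_0_r.
      by apply; exact: tangent_cone0.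
    move=> Fu0; have := T u Fu0; have := T (vscal (-1) u); rewrite mulmvZ Fu0 dotZr => K.
    suff : -1 * dot (vadd p (mulmv (wsum_mat (S x) mu) q)) u <= 0 by lra.
    by apply: K; vext; ring.
  exists (trmulmv Q (vadd p (mulmv (wsum_mat (S x) mu) q))); split.
    exact: tr_kernel_range.
  split=> // w; rewrite -(vcat_vfst_vsnd w) dot_vcat dot_trmulmv => Tw.
  by apply: H; rewrite FQ.
split.
  rewrite /gph vfst_vcat vsnd_vcat; apply/(reg_normal_preimage _ L); exists mu; split=> //.
  by move: Gx; rewrite /gph vfst_vcat vsnd_vcat.
move=> w; rewrite -(vcat_vfst_vsnd w) dot_vcat => /(tangent_gph_normal _ _ _ L) [m [-> T]].
by rewrite key E dot_trmulmv -dot_vcat; exact: Ha.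
Qed.

(** The regular formula is used at each x_k with multiplier mu + t_k m_k, then passed to the limit.
    Forward, the a_k converge because F(x_k)^T a_k does; backward, [q] must be corrected at each
    index. *)
Lemma lim_normal_gph_normal n d (f : vec n -> vec d) F S A Th x mu u m p q :
  submersion_at f F S A Th x ->
  lim_normal_dir (gph (reg_normal A)) (vcat x (trmulmv (F x) mu))
    (vcat u (vadd (trmulmv (F x) m) (mulmv (wsum_mat (S x) mu) u))) (vcat p q) <->
  exists a, vadd p (mulmv (wsum_mat (S x) mu) q) = trmulmv (F x) a /\
    lim_normal_dir (gph (reg_normal Th)) (vcat (f x) mu) (vcat (mulmv (F x) u) m)
      (vcat a (mulmv (F x) q)).
Proof.
move=> L; have [C [Q FQ] _] := L; split.
  move=> /lim_normal_dir_gphP [t [uk [usk [pk [qk [t0 [tl [ul [usl [pl [ql H]]]]]]]]]]].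
  have Xx := vlim_small x tl ul.
  have HA : ev (fun k => reg_normal A (vadd x (vscal (t k) (uk k)))
                 (vadd (trmulmv (F x) mu) (vscal (t k) (usk k)))).
    by apply: ev_mono H => k [] ; rewrite /gph vfst_vcat vsnd_vcat.
  have [vk [mk [m' [vl [ml [E [fv Hk]]]]]]] := normal_gph_push L t0 tl ul usl HA.
  have {E} mm' : m' = m.
    rewrite -(tr_right_inv FQ m') -(tr_right_inv FQ m); congr trmulmv.
    apply: functional_extensionality => i; have := congr1 (fun w : vec n => w i) E.
    by rewrite /vadd; lra.
  rewrite {}mm' in ml.
  have : ev (fun k => exists a,
      vadd (pk k) (mulmv (wsum_mat (S (vadd x (vscal (t k) (uk k))))
         (vadd mu (vscal (t k) (mk k)))) (qk k)) =
      trmulmv (F (vadd x (vscal (t k) (uk k)))) a /\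
      reg_normal (gph (reg_normal Th))
        (vcat (vadd (f x) (vscal (t k) (vk k))) (vadd mu (vscal (t k) (mk k))))
        (vcat a (mulmv (F (vadd x (vscal (t k) (uk k)))) (qk k)))).
    apply: ev_mono (ev_and (ev_and H Hk) (submersion_ev L Xx)) => k [[Gk [Ek _]] Lk].
    by move: Gk; rewrite Ek => /(reg_normal_gph_normal _ _ _ Lk); rewrite fv.
  move=> /ev_choice [ak Hak].
  have FF := C2_with_cvg C Xx.
  have Fa : vlim (fun k => trmulmv (F (vadd x (vscal (t k) (uk k)))) (ak k))
                 (vadd p (mulmv (wsum_mat (S x) mu) q)).
    apply: vlim_ext_ev (vlimD pl (vlim_mulmv
      (C2_with_cvg_hess C Xx (vlim_small mu tl ml)) ql)).
    by apply: ev_mono Hak => k [].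
  have al := trmulmv_lim_inv FQ FF Fa.
  eexists; split; first exact: vlim_unique Fa (vlim_trmulmv FF al).
  apply/lim_normal_dir_gphP; exists t, vk, mk, ak.
  exists (fun k => mulmv (F (vadd x (vscal (t k) (uk k)))) (qk k)); do 5!split=> //.
  split; first exact: vlim_mulmv.
  by apply: ev_mono Hak => k [].
move=> [a [E /lim_normal_dir_gphP [t [vk [mk [ak [bk [t0 [tl [vl [ml [al [bl H]]]]]]]]]]]]].
have HT : ev (fun k => reg_normal Th (vadd (f x) (vscal (t k) (vk k)))
                 (vadd mu (vscal (t k) (mk k)))).
  by apply: ev_mono H => k []; rewrite /gph vfst_vcat vsnd_vcat.
have [uk [usk [ul [usl Hk]]]] := normal_gph_pull L t0 tl vl ml HT.
have Xx := vlim_small x tl ul; have FF := C2_with_cvg C Xx.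
have [r [r0 Hr]] := near_solvable C FQ.
have : ev (fun k => exists e,
    nrm e <= 2 * nrm (vsub (bk k) (mulmv (F (vadd x (vscal (t k) (uk k)))) q)) /\
    mulmv (F (vadd x (vscal (t k) (uk k)))) (mulmv Q e) =
    vsub (bk k) (mulmv (F (vadd x (vscal (t k) (uk k)))) q)).
  by apply: ev_mono (Un_cv_lt ((vlim_nrm _ _).1 Xx) r0) => k xr; exact: Hr.
move=> /ev_choice [ek Hek].
have el : vlim ek (@vzero d).
  apply: (vlim_squeeze (v := fun k =>
      2 * nrm (vsub (bk k) (mulmv (F (vadd x (vscal (t k) (uk k)))) q)))).
    apply: ev_mono Hek => k [He _].
    by have -> : vsub (ek k) (@vzero d) = ek k by vext; ring.
  rewrite -(Rmult_0_r 2); apply: CV_mult (Un_cv_cst 2) _.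
  have := (vlim_nrm _ _).1 (vlimB bl (vlim_mulmv FF (vlim_cst q))).
  apply: Un_cv_eq => k; congr nrm; by vext; ring.
(* The correction makes F(x_k) q_k = b_k hold exactly. The first components are then dictated by p_k
   = F(x_k)^T a_k - B_k q_k. *)
pose qk k := vadd q (mulmv Q (ek k)).
have ql : vlim qk q.
  have -> : q = vadd q (mulmv Q (@vzero d)) by rewrite mulmv0; vext; ring.
  exact: vlimD (vlim_cst _) (vlim_mulmv (mlim_cst _) el).
pose B k := wsum_mat (S (vadd x (vscal (t k) (uk k)))) (vadd mu (vscal (t k) (mk k))).
have Bl : mlim B (wsum_mat (S x) mu) := C2_with_cvg_hess C Xx (vlim_small mu tl ml).
apply/lim_normal_dir_gphP; exists t, uk, usk.
exists (fun k => vsub (trmulmv (F (vadd x (vscal (t k) (uk k)))) (ak k)) (mulmv (B k) (qk k))), qk.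
do 4!split=> //; split.
  have -> : p = vsub (trmulmv (F x) a) (mulmv (wsum_mat (S x) mu) q).
    by rewrite -E; vext; ring.
  exact: vlimB (vlim_trmulmv FF al) (vlim_mulmv Bl ql).
split=> //.
apply: ev_mono (ev_and (ev_and H Hk) (ev_and Hek (submersion_ev L Xx))).
move=> k [[Gk [fk [Ek _]]] [[_ He] Lk]].
rewrite Ek; apply/(reg_normal_gph_normal _ _ _ Lk); exists (ak k); split.
  by rewrite /B; vext; ring.
rewrite fk /qk mulmvD He.
by have -> : vadd (mulmv (F (vadd x (vscal (t k) (uk k)))) q)
  (vsub (bk k) (mulmv (F (vadd x (vscal (t k) (uk k)))) q)) = bk k by vext; ring.
Qed.

(** * The composite map *)

Lemma is_partial_dot n s (g : vec n -> vec s) (lam l : vec s) j x :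
  (forall i, is_partial (fun y => g y i) j x (l i)) ->
  is_partial (fun y => dot lam (g y)) j x (dot lam l).
Proof.
move=> gl; rewrite /is_partial /dot; elim: (index_enum _) => [|i r IH].
  have -> : (fun t => \big[Rplus/0]_(i <- [::])
      (lam i * g (vadd x (vscal t (ebasis j))) i)) = fct_cte 0.
    by apply: functional_extensionality => t; rewrite big_nil.
  by rewrite big_nil; exact: derivable_pt_lim_const.
have -> : (fun t => \big[Rplus/0]_(k <- i :: r)
      (lam k * g (vadd x (vscal t (ebasis j))) k)) =
  plus_fct (mult_real_fct (lam i) (fun t => g (vadd x (vscal t (ebasis j))) i))
    (fun t => \big[Rplus/0]_(k <- r) (lam k * g (vadd x (vscal t (ebasis j))) k)).
  by apply: functional_extensionality => t; rewrite big_cons.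
rewrite big_cons; apply: derivable_pt_lim_plus => //.
exact: derivable_pt_lim_scal (gl i).
Qed.

Lemma hessian_dot n s (g : vec n -> vec s) (lam : vec s) x : C2 g ->
  hessian (fun y => dot lam (g y)) x =
  wsum_mat (fun i => hessian (fun y => g y i) x) lam.
Proof.
move=> Cg; apply: functional_extensionality => j; apply: functional_extensionality => k.
have dj : pderiv (fun y => dot lam (g y)) j =
    fun y => dot lam (fun i => pderiv (fun y => g y i) j y).
  apply: functional_extensionality => y; apply: pderiv_unique; apply: is_partial_dot => i.
  by apply: pderivP; have [H _] := Cg i.
rewrite /hessian dj; apply: pderiv_unique.
apply: (is_partial_dot (g := fun y i => pderiv (fun y => g y i) j y)) => i.
by apply: pderivP; have [_ [H _]] := Cg i.
Qed.

Lemma submersion_comp n s d (h : vec s -> vec d) H SH (g : vec n -> vec s) G SG D Th x :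
  submersion_at h H SH D Th (g x) -> C2_with g G SG ->
  (forall y, exists u v, mulmv (H (g x)) v = @vzero d /\ y = vadd (mulmv (G x) u) v) ->
  submersion_at (fun x => h (g x)) (fun x => matmul (H (g x)) (G x))
    (fun x => comp_hess (H (g x)) (SH (g x)) (G x) (SG x)) (fun x => D (g x)) Th x.
Proof.
move=> [Ch [Q HQ] [r [r0 Hr]]] Cg A2; split.
- exact: C2_with_comp.
(* Write Q y = G u + v with v in the kernel of H, by (A2); applying H gives y = H G u. *)
- apply: right_invertible_surj => y; have [u [v [Hv E]]] := A2 (mulmv Q y).
  exists u; rewrite mulmv_matmul -[RHS]HQ E mulmvD Hv.
  by vext; ring.
- have [|e [e0 He]] := @vcont_comp _ _ (fun z => nrm (vsub z (g x))) g x _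
    (fun i => sdiff_cont (C2_with_grad Cg x i)) r r0.
    move=> eps e0; exists eps; split=> // y yx.
    by rewrite nrm_subxx Rminus_0_r Rabs_pos_eq //; exact: nrm_ge0.
  exists e; split=> // y /He; rewrite nrm_subxx Rminus_0_r Rabs_pos_eq; last exact: nrm_ge0.
  exact: Hr.
Qed.

(** Both coderivatives are expressed by normals to gph N_Theta at the same point (h(g x), mu) and in
    the same direction (H G u, eta). The definitions of [lam] and [xi] are what makes these data
    coincide. *)
Lemma dir_coderiv_normal_comp n s d (h : vec s -> vec d) H SH (g : vec n -> vec s) G SG
    D Th x mu u eta w ws :
  submersion_at h H SH D Th (g x) ->
  submersion_at (fun x => h (g x)) (fun x => matmul (H (g x)) (G x))
    (fun x => comp_hess (H (g x)) (SH (g x)) (G x) (SG x)) (fun x => D (g x)) Th x ->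
  let lam := trmulmv (H (g x)) mu in
  let xi := vadd (trmulmv (H (g x)) eta) (mulmv (wsum_mat (SH (g x)) mu) (mulmv (G x) u)) in
  dir_coderiv (reg_normal (fun x => D (g x))) x (trmulmv (G x) lam) u
    (vadd (trmulmv (G x) xi) (mulmv (wsum_mat (SG x) lam) u)) w ws <->
  exists eta0, dir_coderiv (reg_normal D) (g x) lam (mulmv (G x) u) xi
                 (mulmv (G x) w) eta0 /\
    ws = vadd (mulmv (wsum_mat (SG x) lam) w) (trmulmv (G x) eta0).
Proof.
move=> Lh Lf lam xi; rewrite /dir_coderiv.
have -> : vadd (trmulmv (G x) xi) (mulmv (wsum_mat (SG x) lam) u) =
  vadd (trmulmv (matmul (H (g x)) (G x)) eta)
    (mulmv (wsum_mat (comp_hess (H (g x)) (SH (g x)) (G x) (SG x)) mu) u).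
  by rewrite mulmv_wsum_comp -/lam trmulmv_matmul /xi trmulmvD; vext; ring.
rewrite -trmulmv_matmul (lim_normal_gph_normal _ _ _ _ _ Lf).
rewrite !mulmv_matmul !voppE !mulmvZ mulmv_wsum_comp -/lam.
split=> [[a [E Ha]]|[eta0 [Heta ->]]].
  (* Solving eta0 + B_h(-G w) = H^T a for [eta0], since the second normal component over D is -G
     w. *)
  exists (vadd (mulmv (wsum_mat (SH (g x)) mu) (mulmv (G x) w)) (trmulmv (H (g x)) a)).
  split.
    apply/(lim_normal_gph_normal _ _ _ _ _ Lh); exists a; rewrite !mulmvZ; split=> //.
    by vext; ring.
  rewrite trmulmvD -trmulmv_matmul -E; vext; ring.
have {Heta} [a [E Ha]] := (lim_normal_gph_normal _ _ _ _ _ Lh).1 Heta.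
exists a; rewrite trmulmv_matmul -E; split; last by move: Ha; rewrite ?mulmvZ.
by rewrite trmulmvD ?mulmvZ trmulmvZ; vext; ring.
Qed.

Theorem mainTheorem7 (n s : nat) (g : vec n -> vec s) (D : vset s) (xb : vec n)
  (Hg : C2 g) (HD : vclosed D) (Hxb : D (g xb)) (HA : A1_A2 g D xb)
  (xs : vec n) (Hxs : reg_normal (fun x => D (g x)) xb xs)
  (lam : vec s) (Hlam1 : reg_normal D (g xb) lam)
  (Hlam2 : trmulmv (jacobian g xb) lam = xs) :
  (forall (u us : vec n) (xi : vec s),
     tangent_cone (gph (reg_normal (fun x => D (g x)))) (vcat xb xs) (vcat u us) ->
     tangent_cone (gph (reg_normal D)) (vcat (g xb) lam)
                  (vcat (mulmv (jacobian g xb) u) xi) ->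
     us = vadd (trmulmv (jacobian g xb) xi)
               (mulmv (hessian (fun x => dot lam (g x)) xb) u) ->
     forall (w : vec n) (ws : vec n),
       dir_coderiv (reg_normal (fun x => D (g x))) xb xs u us w ws <->
       exists eta0 : vec s,
         dir_coderiv (reg_normal D) (g xb) lam (mulmv (jacobian g xb) u) xi
                     (mulmv (jacobian g xb) w) eta0 /\
         ws = vadd (mulmv (hessian (fun x => dot lam (g x)) xb) w)
                   (trmulmv (jacobian g xb) eta0))
  /\
  (forall (w : vec n) (ws : vec n),
     coderiv (reg_normal (fun x => D (g x))) xb xs w ws <->
     exists eta0 : vec s,
       coderiv (reg_normal D) (g xb) lam (mulmv (jacobian g xb) w) eta0 /\
       ws = vadd (mulmv (hessian (fun x => dot lam (g x)) xb) w)
                 (trmulmv (jacobian g xb) eta0)).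
Proof.
have [d [Th [h [V [_ [Ch [[r [r0 HV]] [Hsurj [DV A2]]]]]]]]] := HA.
have Lh : submersion_at h (jacobian h) (fun x i => hessian (fun y => h y i) x) D Th (g xb).
  split; [exact: C2_with_jacobian|exact: right_invertible_surj|].
  exists r; split=> // z zr; apply/DV/HV; apply: Rle_lt_trans zr; exact: vnorm_le_nrm.
have Lf := submersion_comp Lh (C2_with_jacobian Hg) A2.
have [mu [lamE _]] := (reg_normal_preimage _ Lh).1 Hlam1.
rewrite hessian_dot // -Hlam2 lamE; split.
  move=> u us xi _ T -> w ws.
  (* Tangency of (G u, xi) puts [xi] in the form H^T eta + B_h G u required by the comparison. *)
  have [eta [-> _]] := (tangent_gph_normal _ _ _ Lh).1 T.
  exact: (dir_coderiv_normal_comp _ _ _ _ _ Lh Lf).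
move=> w ws.
(* For u = 0 and eta = 0 both directions collapse to zero, which gives the non-directional
   coderivatives. *)
have := dir_coderiv_normal_comp mu (@vzero n) (@vzero d) w ws Lh Lf.
rewrite /coderiv !mulmv0 !trmulmv0.
have v0 k : vadd (@vzero k) (@vzero k) = @vzero k by vext; ring.
by rewrite !v0 trmulmv0 v0.
Qed.
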